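(* Let $(T,\preceq,\Sigma,\mathcal S,\mathcal M)$ be an $(\mathcal S,\mathcal M)$-tree. Then for every pair $n,k\in\omega$ and every colouring $\chi$ of $\mathcal{AM}^n_k$ with finitely many colours, there exists $F\in\mathcal M^n$ such that $\chi$ is constant on $\{F\circ g: g\in\mathcal{AM}^n_k\}$.
   Context: A tree is a partially ordered set $(T,\preceq)$ such that for every $a\in T$ the set $\{b\in T:b\prec a\}$ is finite and linearly ordered by $\preceq$. The level of $a$ is $\ell(a)=|\{b\in T:b\prec a\}|$; $T(n)=\{a\in T:\ell(a)=n\}$, and $T(\le n)$, $T(<n)$ are defined analogously. For $a\in T$ and $n\le \ell(a)$, $a|_n$ denotes the unique predecessor of $a$ at level $n$ (with $a|_{\ell(a)}=a$). A node $b$ is an immediate successor of $a$ if $a\prec b$ and there is no $c$ with $a\prec c\prec b$. An $\mathcal S$-tree is a quadruple $(T,\preceq,\Sigma,\mathcal S)$ where $(T,\preceq)$ is a countable tree in which every node has finitely many immediate successors and $T(0)$ is finite, $\Sigma$ is a set, and $\mathcal S\colon T\times T^{<\omega}\times\Sigma\to T$ is a partial function such that: (S1) if $\mathcal S(a,\bar p,c)$ is defined then it is an immediate successor of $a$ and every entry of $\bar p$ has level at most $\ell(a)-1$; (S2) if $\mathcal S(a,\bar p,c)=\mathcal S(b,\bar q,d)$ then $a=b$, $\bar p=\bar q$ and $c=d$; (S3) for every $a\in T$ and every immediate successor $b$ of $a$ there are $\bar p\in T^{<\omega}$ and $c\in\Sigma$ with $b=\mathcal S(a,\bar p,c)$.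 For $S\subseteq T$, a map $f\colon S\to T$ is level-preserving if $\ell(a)=\ell(b)$ implies $\ell(f(a))=\ell(f(b))$; then $\tilde f(n)$ denotes $\ell(f(a))$ for any $a\in S$ with $\ell(a)=n$. An injection $F\colon T\to T$ is shape-preserving if (i) it is level-preserving; (ii) whenever $\mathcal S(a,\bar p,c)$ is defined, $\mathcal S(F(a),F(\bar p),c)$ is defined and $\mathcal S(F(a),F(\bar p),c)\preceq F(\mathcal S(a,\bar p,c))$, where $F(\bar p)$ is the tuple of images of the entries of $\bar p$; (iii) for every $a\in T(0)$ and $b\in T$ with $a\preceq b$ we have $a\preceq F(b)$. For $S\subseteq T$, a map $f\colon S\to T$ is shape-preserving if it extends to a shape-preserving $F\colon T\to T$. A shape-preserving $F$ skips level $m$ if $m\notin\tilde F[\omega]$, and skips only level $m$ if $\tilde F[\omega]=\omega\setminus\{m\}$. An $(\mathcal S,\mathcal M)$-tree is a quintuple $(T,\preceq,\Sigma,\mathcal S,\mathcal M)$ where $(T,\preceq,\Sigma,\mathcal S)$ is an $\mathcal S$-tree and $\mathcal M$ is a set of shape-preserving functions $T\to T$ such that: (M1) $\mathrm{Id}_T\in\mathcal M$, $\mathcal M$ is closed under composition, and whenever $(F_i)_{i\in\omega}$ is a sequence in $\mathcal M$ with $F_i\restriction T(\le i)=F_{i+1}\restriction T(\le i)$ for all $i$, there is $F_\infty\in\mathcal M$ with $F_\infty\restriction T(\le i)=F_i\restriction T(\le i)$ for all $i$; (M2) for every $n\in\omega$ and every $F\in\mathcal M$ with $\tilde F(n)>0$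 which skips level $\tilde F(n)-1$, there are $F_1,F_2\in\mathcal M$ such that $F_2$ skips only level $\tilde F(n)-1$ and $(F_2\circ F_1)\restriction T(\le n)=F\restriction T(\le n)$; (M3) for all $n<m$ in $\omega$ there is $F^n_m\in\mathcal M$ skipping only level $m$ such that $F^n_m(b)=\mathcal S(b,\bar p,c)$ whenever $a\in T(n)$, $b\in T(m)$, $\bar p\in T^{<\omega}$, $c\in\Sigma$, $\mathcal S(a,\bar p,c)$ is defined and $\mathcal S(a,\bar p,c)\preceq b$. Notation: $\mathcal M^n=\{F\in\mathcal M: F\restriction T(<n)\text{ is the identity}\}$; $\mathcal{AM}=\{F\restriction T(<k): F\in\mathcal M,\ k>0\}$; $\mathcal{AM}^n_k=\{F\restriction T(<n+k):F\in\mathcal M^n\}$; $\mathcal{AM}^n_k(\le m)=\{f\in\mathcal{AM}^n_k:\tilde f(n+k-1)\le m\}$; $\mathcal{AM}^n_k(m)=\{f\in\mathcal{AM}^n_k:\tilde f(n+k-1)=m\}$. *)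

(* Defs.v *)
From Stdlib Require Import List Arith ClassicalEpsilon.
Import ListNotations.
Set Implicit Arguments.

Section Trees.
Context {T : Type} (le : T -> T -> Prop).

Definition lt (a b : T) : Prop := le a b /\ a <> b.

Definition is_tree : Prop :=
  (forall a, le a a) /\
  (forall a b, le a b -> le b a -> a = b) /\
  (forall a b c, le a b -> le b c -> le a c) /\
  (forall a, exists l : list T, forall b, lt b a <-> In b l) /\
  (forall a b c, lt b a -> lt c a -> le b c \/ le c b).

Definition is_level (a : T) (n : nat) : Prop :=
  exists l : list T, NoDup l /\ (forall b, lt b a <-> In b l) /\ length l = n.

(* ell(a) = |{b : b < a}| (well defined on a tree) *)
Definition level (a : T) : nat := epsilon (inhabits 0) (fun n => is_level a n).

Definition imm_succ (a b : T) : Prop :=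
  lt a b /\ ~ (exists c, lt a c /\ lt c b).

Definition countable_type : Prop := exists f : T -> nat, forall x y, f x = f y -> x = y.

Context {Sigma : Type} (Ssucc : T -> list T -> Sigma -> option T).

Definition is_S_tree : Prop :=
  is_tree /\ countable_type /\
  (forall a, exists l : list T, forall b, imm_succ a b <-> In b l) /\
  (exists l : list T, forall a, level a = 0 <-> In a l) /\
  (forall a p c b, Ssucc a p c = Some b ->
      imm_succ a b /\ (forall q, In q p -> level q < level a)) /\
  (forall a p c b q d x, Ssucc a p c = Some x -> Ssucc b q d = Some x ->
      a = b /\ p = q /\ c = d) /\
  (forall a b, imm_succ a b -> exists p c, Ssucc a p c = Some b).

Definition level_preserving (F : T -> T) : Prop :=
  forall a b, level a = level b -> level (F a) = level (F b).

Definition shape_preserving (F : T -> T) : Prop :=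
  (forall x y, F x = F y -> x = y) /\
  level_preserving F /\
  (forall a p c b, Ssucc a p c = Some b ->
     exists b', Ssucc (F a) (map F p) c = Some b' /\ le b' (F b)) /\
  (forall a b, level a = 0 -> le a b -> le a (F b)).

Definition hits_level (F : T -> T) (m : nat) : Prop := exists a, level (F a) = m.
Definition skips (F : T -> T) (m : nat) : Prop := ~ hits_level F m.
Definition skips_only (F : T -> T) (m : nat) : Prop :=
  forall j, hits_level F j <-> j <> m.

Context (M : (T -> T) -> Prop).

Definition is_SM_tree : Prop :=
  is_S_tree /\
  (forall F, M F -> shape_preserving F) /\
  M (fun x => x) /\
  (forall F G, M F -> M G -> M (fun x => F (G x))) /\
  (forall Fs : nat -> T -> T, (forall i, M (Fs i)) ->
     (forall i a, level a <= i -> Fs i a = Fs (S i) a) ->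
     exists Finf, M Finf /\ forall i a, level a <= i -> Finf a = Fs i a) /\
  (* (M2): a at level n, so level (F a) = tilde F(n) *)
  (forall n F a, M F -> level a = n -> 0 < level (F a) ->
     skips F (level (F a) - 1) ->
     exists F1 F2, M F1 /\ M F2 /\ skips_only F2 (level (F a) - 1) /\
       forall b, level b <= n -> F2 (F1 b) = F b) /\
  (forall n m, n < m -> exists F, M F /\ skips_only F m /\
     forall a b p c s, level a = n -> level b = m -> Ssucc a p c = Some s -> le s b ->
       Ssucc b p c = Some (F b)).

Definition M_from (n : nat) (F : T -> T) : Prop :=
  M F /\ forall a, level a < n -> F a = a.

Definition AM (n k : nat) (g : T -> option T) : Prop :=
  exists F, M_from n F /\
    forall a, g a = if level a <? n + k then Some (F a) else None.

Definition comp_partial (F : T -> T) (g : T -> option T) : T -> option T :=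
  fun a => option_map F (g a).

End Trees.

(* Main.v *)
Require Import Defs.
From Stdlib Require Import List Arith Lia ClassicalEpsilon FunctionalExtensionality
  PropExtensionality.
Import ListNotations.

(** Let [tilde F] be the map on levels induced by [F].  By (M2) an element of [AM^n_1] is a
    composition of one-level steps, that is, a word, and (M3) allows letters to be repeated.
    The Hales-Jewett theorem gives, for a finitely coloured set of words, a word [w] and a
    left variable word extending it such that [w] and all instances have the same colour.

    Call a set [Y] of words at level [l] large if it meets every [{F o g : g}], [F] in
    [M^l].  If [Y] is large then, for some [N], every word [z] starting at [N] can
    be completed by a word [g] from [l] to [N] with [z o g] in [Y].  Colouring [z] by [g] and
    taking a monochromatic left variable word shows that a large set contains a word whose
    left variable extensions in [Y] are again large (up to passing to a copy of the tree);
    iterating, [Y] contains a whole copy.  Since either one colour class is large or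
    it is avoided by some copy, this settles [k = 1].  For larger [k], a fusion
    makes the colour of [f] in [AM^n_{k+1}] depend on [f] restricted to [T(<n+k)] only: by
    (M2), [f = h o f'] where [f'] is determined by that restriction and [h] ranges over some
    [AM^m_1]. *)

(** * The Hales-Jewett theorem *)

Fixpoint vecs {X : Type} (l : list X) (n : nat) : list (list X) :=
  match n with
  | 0 => [[]]
  | S n' => flat_map (fun x => map (cons x) (vecs l n')) l
  end.

Lemma in_vecs {X : Type} (l : list X) n u :
  In u (vecs l n) <-> length u = n /\ incl u l.
Proof.
  revert u; induction n as [|n IH]; intros u; simpl.
  - split.
    + intros [<-|[]]; split; [reflexivity|intros x []].
    + intros [H _]; destruct u; [auto|discriminate].
  - rewrite in_flat_map; split.
    + intros [x [Hx H]]; apply in_map_iff in H as [u' [<- H]].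
      apply IH in H as [H1 H2]; split; [simpl; congruence|].
      intros y [<-|Hy]; auto.
    + intros [H1 H2]; destruct u as [|x u]; [discriminate|].
      exists x; split; [apply H2; simpl; auto|].
      apply in_map, IH; split; [simpl in H1; congruence|].
      intros y Hy; apply H2; simpl; auto.
Qed.

Lemma length_vecs {X : Type} (l : list X) n : length (vecs l n) = length l ^ n.
Proof.
  induction n as [|n IH]; simpl; [reflexivity|].
  rewrite (flat_map_constant_length (c := length l ^ n)).
  - reflexivity.
  - intros x _; rewrite length_map; exact IH.
Qed.

Lemma pigeonhole {X : Type} (x : nat -> X) (L : list X) :
  (forall i, i <= length L -> In (x i) L) ->
  exists i j, i < j /\ j <= length L /\ x i = x j.
Proof.
  intros H.
  destruct (classic (exists i j, i < j /\ j <= length L /\ x i = x j)) as [|Hn];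
    [assumption|exfalso].
  assert (Hd : NoDup (map x (seq 0 (S (length L))))).
  { apply NoDup_map_NoDup_ForallPairs; [|apply seq_NoDup].
    intros i j Hi Hj E; apply in_seq in Hi, Hj.
    destruct (Nat.lt_trichotomy i j) as [Hl|[Hl|Hl]]; [|assumption|];
      exfalso; apply Hn; [exists i, j|exists j, i]; repeat split; auto; lia. }
  assert (Hl : length (map x (seq 0 (S (length L)))) <= length L).
  { apply NoDup_incl_length; [assumption|].
    intros y Hy; apply in_map_iff in Hy as [i [<- Hi]].
    apply in_seq in Hi; apply H; lia. }
  rewrite length_map, length_seq in Hl; lia.
Qed.

Section Words.
Context {A : Type}.

Definition subst (a : A) (v : list (option A)) : list A :=
  map (fun o => match o with Some b => b | None => a end) v.

Definition letters_in (al : list A) (v : list (option A)) : Prop :=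
  forall b, In (Some b) v -> In b al.

Lemma subst_app a v w : subst a (v ++ w) = subst a v ++ subst a w.
Proof. apply map_app. Qed.

Lemma length_subst a v : length (subst a v) = length v.
Proof. apply length_map. Qed.

Lemma subst_map_Some a u : subst a (map Some u) = u.
Proof. unfold subst; rewrite map_map; apply map_id. Qed.

Lemma subst_incl al a v : letters_in al v -> In a al -> incl (subst a v) al.
Proof.
  intros Hv Ha b Hb; apply in_map_iff in Hb as [[d|] [<- Hd]]; auto.
Qed.

Lemma letters_in_app al v w :
  letters_in al v -> letters_in al w -> letters_in al (v ++ w).
Proof. intros Hv Hw b Hb; apply in_app_or in Hb as [Hb|Hb]; auto. Qed.

Lemma letters_in_map_Some al u : incl u al -> letters_in al (map Some u).
Proof.
  intros Hu b Hb; apply in_map_iff in Hb as [d [E Hd]].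
  injection E as <-; auto.
Qed.

Lemma letters_in_weaken al al' v : incl al al' -> letters_in al v -> letters_in al' v.
Proof. intros H Hv b Hb; apply H, Hv, Hb. Qed.

(** The colour type is quantified after [t] because the induction applies the statement to colours
    that are themselves lists of colours. *)
Definition hales_jewett (al : list A) : Prop :=
  forall r, exists t, forall (X : Type) (c : list A -> X) (L : list X),
    length L <= r ->
    (forall u, length u = t -> incl u al -> In (c u) L) ->
    exists v, length v = t /\ In None v /\ letters_in al v /\
      forall a b, In a al -> In b al -> c (subst a v) = c (subst b v).

(* [vs] is a sequence of variable words over [al], each of which may be evaluated at any
   letter of [al'] without changing the colour, whatever stands before it, provided
   that all the later ones are evaluated at [alpha]. *)
Fixpoint chain {X : Type} (c : list A -> X) (al al' : list A) (alpha : A)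
  (T : nat) (vs : list (list (option A))) : Prop :=
  match vs with
  | [] => True
  | v :: vs' =>
      In None v /\ letters_in al v /\
      (forall q a, length q = T -> incl q al -> In a al' ->
         c (q ++ subst a v ++ concat (map (subst alpha) vs')) =
         c (q ++ subst alpha v ++ concat (map (subst alpha) vs'))) /\
      chain c al al' alpha (T + length v) vs'
  end.

Lemma length_concat_subst a (vs : list (list (option A))) :
  length (concat (map (subst a) vs)) = length (concat vs).
Proof.
  induction vs as [|v vs IH]; simpl; [reflexivity|].
  rewrite !length_app, IH, length_subst; reflexivity.
Qed.

Lemma concat_subst_incl {X : Type} (c : list A -> X) al al' alpha a T vs :
  chain c al al' alpha T vs -> In a al -> incl (concat (map (subst a) vs)) al.
Proof.
  revert T; induction vs as [|v vs IH]; intros T Hc Ha; simpl in *.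
  - intros x [].
  - destruct Hc as (_ & Hv & _ & Hc); apply incl_app; [|eauto].
    apply subst_incl; assumption.
Qed.

(** Shelah's construction: the blocks are found from the last to the first, while their lengths are
    fixed from the first to the last. Once the later blocks are set to [alpha], only the words [q]
    in front vary, so the length [t1] does not depend on [t2]. *)
Lemma chain_exists al al' alpha :
  hales_jewett al' -> In alpha al' -> incl al' al ->
  forall r j T, exists t, forall (X : Type) (c : list A -> X) (L : list X),
    length L <= r ->
    (forall u, length u = T + t -> incl u al -> In (c u) L) ->
    exists vs, length vs = j /\ length (concat vs) = t /\ chain c al al' alpha T vs.
Proof.
  intros HJ Halpha Hincl r j; induction j as [|j IH]; intros T.
  - exists 0; intros X c L _ _; exists []; simpl; auto.
  - destruct (HJ (r ^ length (vecs al T))) as [t1 Ht1].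
    destruct (IH (T + t1)) as [t2 Ht2].
    exists (t1 + t2); intros X c L HL Hc.
    destruct (Ht2 X c L HL) as (vs & Hj & Hlen & Hch).
    { intros u Hu Hin; apply Hc; [lia|assumption]. }
    set (s := concat (map (subst alpha) vs)) in *.
    (* The colour of a word is the list of its colours behind all [q], so that one line serves every
       [q] at once. *)
    destruct (Ht1 _ (fun u => map (fun q => c (q ++ u ++ s)) (vecs al T))
                (vecs L (length (vecs al T)))) as (v & Hv & HN & Hlet & Hmono).
    { rewrite length_vecs; apply Nat.pow_le_mono_l; assumption. }
    { intros u Hu Hin; apply in_vecs; split; [apply length_map|].
      intros x Hx; apply in_map_iff in Hx as [q [<- Hq]].
      apply in_vecs in Hq as [Hq1 Hq2]; apply Hc.
      - rewrite !length_app; unfold s; rewrite length_concat_subst; lia.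
      - repeat apply incl_app; auto.
        + eapply incl_tran; eassumption.
        + eapply concat_subst_incl; eauto. }
    exists (v :: vs); simpl; rewrite length_app; repeat split; auto; try lia.
    + eapply letters_in_weaken; eassumption.
    + intros q a Hq Hqin Ha.
      specialize (Hmono a alpha Ha Halpha); cbv beta in Hmono.
      apply (proj1 (@map_ext_in_iff _ _ (fun q => c (q ++ subst a v ++ s))
                      (fun q => c (q ++ subst alpha v ++ s)) _) Hmono q).
      apply in_vecs; auto.
    + rewrite Hv; assumption.
Qed.

Lemma chain_drop {X : Type} (c : list A -> X) al al' alpha vs1 vs2 T :
  chain c al al' alpha T (vs1 ++ vs2) ->
  chain c al al' alpha (T + length (concat vs1)) vs2.
Proof.
  revert T; induction vs1 as [|v vs1 IH]; intros T; simpl.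
  - rewrite Nat.add_0_r; auto.
  - intros (_ & _ & _ & H); apply IH in H.
    rewrite length_app, Nat.add_assoc; assumption.
Qed.

Lemma chain_concat_incl {X : Type} (c : list A -> X) al al' alpha T vs1 vs2 a :
  chain c al al' alpha T (vs1 ++ vs2) -> In a al ->
  incl (concat (map (subst a) vs1)) al /\ incl (concat (map (subst a) vs2)) al.
Proof.
  intros H Ha; apply (concat_subst_incl _ _ _ _ a) in H; [|assumption].
  rewrite map_app, concat_app in H; split; intros x Hx; apply H, in_or_app; auto.
Qed.

(** The blocks are switched between [alpha] and [a] from the left, one at a time, so that whenever a
    block changes, all later ones still carry [alpha], as [chain] requires. *)
Lemma chain_eval {X : Type} (c : list A -> X) al al' alpha a vs1 vs2 T q :
  incl al' al -> In a al' ->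
  chain c al al' alpha T (vs1 ++ vs2) -> length q = T -> incl q al ->
  c (q ++ concat (map (subst a) vs1) ++ concat (map (subst alpha) vs2)) =
  c (q ++ concat (map (subst alpha) (vs1 ++ vs2))).
Proof.
  intros Hincl Ha; revert T q.
  induction vs1 as [|v vs1 IH]; intros T q Hc Hq Hin; simpl; [reflexivity|].
  simpl in Hc; destruct Hc as (_ & Hv & Hmono & Hc).
  rewrite <- Hmono with (a := a) by auto.
  rewrite <- app_assoc, !(app_assoc q).
  eapply IH; eauto.
  - rewrite length_app, length_subst; lia.
  - apply incl_app; [assumption|apply subst_incl; auto].
Qed.

Lemma chain_letters {X : Type} (c : list A -> X) al al' alpha T vs1 vs2 :
  chain c al al' alpha T (vs1 ++ vs2) -> letters_in al (concat vs1).
Proof.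
  revert T; induction vs1 as [|v vs1 IH]; intros T; simpl; [intros _ b []|].
  intros (_ & Hv & _ & H); apply letters_in_app; eauto.
Qed.

Lemma concat_subst_concat a (vs : list (list (option A))) :
  subst a (concat vs) = concat (map (subst a) vs).
Proof. apply concat_map. Qed.

(** Induction on the alphabet. In a chain of [r] blocks, evaluate the first [i] at the new letter
    [beta] and the rest at [alpha]; two of these [r + 1] words share a colour. The blocks between
    the two positions become the variable: [alpha] and [beta] agree on it by the pigeonhole
    principle, and every other letter agrees with [alpha] by [chain_eval]. *)
Theorem hales_jewett_all (al : list A) : hales_jewett al.
Proof.
  induction al as [|beta al' IH]; intros r.
  { exists 1; intros X c L _ _; exists [None]; simpl; repeat split; auto.
    - intros b [H|[]]; discriminate.
    - intros a b []. }
  destruct al' as [|alpha al0].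
  { exists 1; intros X c L _ _; exists [None]; simpl; repeat split; auto.
    - intros b [H|[]]; discriminate.
    - intros a b [<-|[]] [<-|[]]; reflexivity. }
  set (al' := alpha :: al0) in *; set (al := beta :: al').
  assert (Halpha : In alpha al') by (simpl; auto).
  assert (Hbeta : In beta al) by (simpl; auto).
  assert (Hincl : incl al' al) by (apply incl_tl, incl_refl).
  destruct (chain_exists al al' alpha IH Halpha Hincl r r 0) as [t Ht].
  exists t; intros X c L HL Hc.
  destruct (Ht X c L HL Hc) as (vs & Hlen & Hcat & Hch).
  destruct (pigeonhole (fun i => c (concat (map (subst beta) (firstn i vs)) ++
                                    concat (map (subst alpha) (skipn i vs)))) L)
    as (i & j & Hij & Hj & E).
  { intros i Hi; apply Hc.
    - rewrite length_app, !length_concat_subst, <- length_app, <- concat_app,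
        firstn_skipn; assumption.
    - rewrite <- (firstn_skipn i vs) in Hch.
      apply incl_app; [eapply (proj1 (chain_concat_incl _ _ _ _ _ _ _ _ Hch Hbeta))|
        eapply (proj2 (chain_concat_incl _ _ _ _ _ _ _ alpha Hch (Hincl _ Halpha)))]. }
  pose (v1 := firstn i vs).
  pose (v2 := firstn (j - i) (skipn i vs)).
  pose (v3 := skipn (j - i) (skipn i vs)).
  assert (E2 : skipn i vs = v2 ++ v3) by (symmetry; apply firstn_skipn).
  assert (E0 : vs = v1 ++ v2 ++ v3) by (rewrite <- E2; symmetry; apply firstn_skipn).
  assert (L1 : length v1 = i) by (unfold v1; rewrite length_firstn; lia).
  assert (L2 : length v2 = j - i)
    by (unfold v2; rewrite length_firstn, length_skipn; lia).
  assert (E3 : firstn j vs = v1 ++ v2).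
  { rewrite E0, app_assoc, firstn_app, firstn_all2 by (rewrite length_app; lia).
    rewrite length_app, L1, L2.
    replace (j - (i + (j - i))) with 0 by lia.
    apply app_nil_r. }
  assert (E4 : skipn j vs = v3).
  { unfold v3; rewrite skipn_skipn; f_equal; lia. }
  change (firstn i vs) with v1 in E.
  rewrite E2, E3, E4, !map_app, !concat_app in E.
  assert (I1 : incl (concat (map (subst beta) v1)) al)
    by (rewrite E0 in Hch; exact (proj1 (chain_concat_incl _ _ _ _ _ _ _ _ Hch Hbeta))).
  assert (I3 : incl (concat (map (subst alpha) v3)) al).
  { rewrite E0, app_assoc in Hch.
    exact (proj2 (chain_concat_incl _ _ _ _ _ _ _ _ Hch (Hincl _ Halpha))). }
  assert (Hmono : forall a, In a al ->
    c (concat (map (subst beta) v1) ++ concat (map (subst a) v2) ++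
       concat (map (subst alpha) v3)) =
    c (concat (map (subst beta) v1) ++ concat (map (subst beta) v2) ++
       concat (map (subst alpha) v3))).
  { intros a [<-|Ha]; [reflexivity|].
    rewrite <- app_assoc in E; rewrite <- E.
    rewrite <- (concat_app (map (subst alpha) v2)), <- map_app.
    apply (chain_eval c al al' alpha a v2 v3 (0 + length (concat v1))); auto.
    - apply chain_drop; rewrite <- E0; assumption.
    - rewrite length_concat_subst; reflexivity. }
  exists (map Some (concat (map (subst beta) v1)) ++ concat v2 ++
          map Some (concat (map (subst alpha) v3))).
  assert (Hch2 : chain c al al' alpha (0 + length (concat v1)) (v2 ++ v3))
    by (apply chain_drop; rewrite <- E0; assumption).
  assert (Hlet : letters_in al (concat v2)) by (eapply chain_letters; eassumption).
  assert (HN : In None (concat v2)).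
  { destruct v2 as [|v v2]; [simpl in L2; lia|].
    simpl; apply in_or_app; left; apply Hch2. }
  repeat split.
  - rewrite !length_app, !length_map, !length_concat_subst, <- !length_app,
      <- !concat_app, <- E0; assumption.
  - apply in_or_app; right; apply in_or_app; auto.
  - repeat apply letters_in_app; auto using letters_in_map_Some.
  - intros a b Ha Hb; rewrite !subst_app, !subst_map_Some, !concat_subst_concat.
    rewrite (Hmono a Ha), (Hmono b Hb); reflexivity.
Qed.

(** * Left variable words *)

Lemma split_last_None (v : list (option A)) :
  In None v -> exists v1 p, v = v1 ++ None :: map Some p.
Proof.
  induction v as [|o v IH]; intros H; [destruct H|].
  destruct (classic (In None v)) as [Hv|Hv].
  - destruct (IH Hv) as (v1 & p & ->); exists (o :: v1), p; reflexivity.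
  - destruct H as [->|H]; [|contradiction].
    assert (Hp : exists p, v = map Some p).
    { clear IH; induction v as [|[b|] v IHv]; [exists []; reflexivity| |simpl in Hv; tauto].
      destruct IHv as [p ->]; [simpl in Hv; tauto|exists (b :: p); reflexivity]. }
    destruct Hp as [p ->]; exists [], p; reflexivity.
Qed.

(** Earlier letters stand further right, so [q] is a common beginning of length [T]. A single left
    variable word has to carry [s] to the colour of [s'], for all [q] and all letters. *)
Definition comparable_tails {X : Type} (c : list A -> X) (al : list A)
  (T : nat) (s s' : list A) : Prop :=
  exists v, letters_in al v /\ forall q a, length q = T -> incl q al -> In a al ->
    c (subst a v ++ a :: s ++ q) = c (s' ++ q).

(** Induction on [j]: a Hales-Jewett line [v] that works for all [s i] and [q] is put between them.
    The part [p] of [v] preceding its first variable in reading order becomes the new tail 0.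
    Completing [p] to an instance of [v] followed by [s i'] is a left variable extension, and the
    line keeps its colour constant. *)
Lemma tails_exist {X : Type} (c : list A -> X) (L : list X) al alpha :
  In alpha al -> (forall u, incl u al -> In (c u) L) ->
  forall j T, exists s : nat -> list A,
    (forall i, incl (s i) al) /\
    forall i i', i < i' -> i' < j -> comparable_tails c al T (s i) (s i').
Proof.
  intros Halpha Hc j; induction j as [|j IH]; intros T.
  { exists (fun _ => []); split; [intros _ x []|intros; lia]. }
  set (I := list_prod (seq 0 j) (vecs al T)).
  (* Only the number of pairs of an index and a beginning matters here, so [t] is chosen before the
     old tails, which are then built for beginnings of length [t + T]. *)
  destruct (hales_jewett_all al (length L ^ length I)) as [t Ht].
  destruct (IH (t + T)) as (s & Hs & Hcmp).
  destruct (Ht _ (fun u => map (fun iq => c (s (fst iq) ++ u ++ snd iq)) I)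
              (vecs L (length I))) as (v & Hv & HN & Hlet & Hmono).
  { rewrite length_vecs; reflexivity. }
  { intros u Hu Hin; apply in_vecs; split; [apply length_map|].
    intros x Hx; apply in_map_iff in Hx as [[i q] [<- Hq]].
    apply in_prod_iff in Hq as [_ Hq]; apply in_vecs in Hq as [_ Hq].
    apply Hc; repeat apply incl_app; simpl; auto. }
  assert (Hm : forall i q a, i < j -> length q = T -> incl q al -> In a al ->
    c (s i ++ subst a v ++ q) = c (s i ++ subst alpha v ++ q)).
  { intros i q a Hi Hq Hqi Ha.
    specialize (Hmono a alpha Ha Halpha); cbv beta in Hmono.
    apply (proj1 (@map_ext_in_iff _ _
      (fun iq => c (s (fst iq) ++ subst a v ++ snd iq))
      (fun iq => c (s (fst iq) ++ subst alpha v ++ snd iq)) _) Hmono (i, q)).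
    apply in_prod; [apply in_seq; lia|apply in_vecs; auto]. }
  destruct (split_last_None v HN) as (v1 & p & Ev).
  exists (fun i => match i with 0 => p | S i => s i ++ subst alpha v end); split.
  { intros [|i].
    - intros b Hb; apply Hlet; rewrite Ev; apply in_or_app; right; right.
      apply in_map, Hb.
    - apply incl_app; [apply Hs|apply subst_incl; assumption]. }
  intros [|i] [|i'] Hii Hj; try lia.
  - exists (map Some (s i') ++ v1); split.
    { apply letters_in_app; [apply letters_in_map_Some, Hs|].
      intros b Hb; apply Hlet; rewrite Ev; apply in_or_app; auto. }
    intros q a Hq Hqi Ha.
    rewrite <- app_assoc, <- (Hm i' q a) by (auto; lia).
    rewrite Ev, !subst_app, subst_map_Some; simpl; fold (subst a (map Some p)).
    rewrite subst_map_Some, <- !app_assoc; reflexivity.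
  - destruct (Hcmp i i') as (w & Hw & Hcw); [lia|lia|].
    exists w; split; [assumption|].
    intros q a Hq Hqi Ha; rewrite <- !app_assoc; apply Hcw; auto.
    + rewrite length_app, length_subst; lia.
    + apply incl_app; [apply subst_incl; assumption|assumption].
Qed.

(* Words are written with the last letter first, so that [subst a v ++ a :: s] extends
   [s] by the left variable word given by [v]. *)
Theorem left_variable_word {X : Type} (c : list A -> X) (L : list X) (al : list A) :
  (forall u, incl u al -> In (c u) L) ->
  exists s v, incl s al /\ letters_in al v /\
    forall a, In a al -> c (subst a v ++ a :: s) = c s.
Proof.
  intros Hc; destruct al as [|alpha al0].
  { exists [], []; split; [intros x []|split; [intros b []|intros a []]]. }
  set (al := alpha :: al0) in *.
  destruct (tails_exist c L al alpha (or_introl eq_refl) Hc (S (length L)) 0)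
    as (s & Hs & Hcmp).
  (* If [s i] and [s i'] have the same colour, the extensions of [s i], which have the colour of
     [s i'], have the colour of [s i] itself. *)
  destruct (pigeonhole (fun i => c (s i)) L) as (i & i' & Hii & Hi' & E).
  { intros i _; apply Hc, Hs. }
  destruct (Hcmp i i') as (v & Hv & Hcv); [lia|lia|].
  exists (s i), v; repeat split; auto.
  intros a Ha; rewrite E; specialize (Hcv [] a eq_refl); rewrite !app_nil_r in Hcv.
  apply Hcv; [intros x []|assumption].
Qed.

End Words.

(** * Shape-preserving maps *)

Lemma dependent_choice {X : Type} (Inv : nat -> X -> Prop) (R : nat -> X -> X -> Prop) x0 :
  Inv 0 x0 ->
  (forall i x, Inv i x -> exists x', Inv (S i) x' /\ R i x x') ->
  exists f, f 0 = x0 /\ forall i, Inv i (f i) /\ R i (f i) (f (S i)).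
Proof.
  intros H0 Hstep.
  pose (next := fun i (s : {x | Inv i x}) =>
    constructive_indefinite_description _ (Hstep i (proj1_sig s) (proj2_sig s))).
  pose (g := fix g i : {x | Inv i x} :=
    match i with
    | 0 => exist _ x0 H0
    | S i' => exist _ (proj1_sig (next i' (g i'))) (proj1 (proj2_sig (next i' (g i'))))
    end).
  exists (fun i => proj1_sig (g i)); split; [reflexivity|].
  intros i; split; [apply proj2_sig|].
  exact (proj2 (proj2_sig (next i (g i)))).
Qed.

Lemma NoDup_exists {X : Type} (l : list X) :
  exists l', NoDup l' /\ forall x, In x l <-> In x l'.
Proof.
  induction l as [|x l (l' & Hd & Hl)].
  - exists []; split; [constructor|reflexivity].
  - destruct (classic (In x l')) as [Hx|Hx].
    + exists l'; split; [assumption|]; intros y; simpl; rewrite Hl.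
      split; [intros [<-|]; auto|auto].
    + exists (x :: l'); split; [constructor; assumption|].
      intros y; simpl; rewrite Hl; reflexivity.
Qed.

Section SMTree.
Context {T : Type} (le : T -> T -> Prop) {Sigma : Type}
  (Ssucc : T -> list T -> Sigma -> option T) (M : (T -> T) -> Prop)
  (HT : is_SM_tree le Ssucc M).

Local Notation ell := (level le).
Local Notation "a ≼ b" := (le a b) (at level 70).
Local Notation "a ≺ b" := (Defs.lt le a b) (at level 70).

(** * Order, levels and finiteness of the tree *)

Lemma le_refl a : a ≼ a.
Proof. apply HT. Qed.

Lemma le_antisym a b : a ≼ b -> b ≼ a -> a = b.
Proof. apply HT. Qed.

Lemma le_trans a b c : a ≼ b -> b ≼ c -> a ≼ c.
Proof. apply HT. Qed.

Lemma lt_linear a b c : b ≺ a -> c ≺ a -> b ≼ c \/ c ≼ b.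
Proof. apply HT. Qed.

Lemma le_lt_or_eq a b : a ≼ b -> a ≺ b \/ a = b.
Proof. intros H; destruct (classic (a = b)); [auto|left; split; assumption]. Qed.

Lemma le_linear a b c : b ≼ a -> c ≼ a -> b ≼ c \/ c ≼ b.
Proof.
  intros Hb Hc.
  destruct (le_lt_or_eq _ _ Hb) as [Hb'| ->]; [|auto].
  destruct (le_lt_or_eq _ _ Hc) as [Hc'| ->]; [|auto].
  eapply lt_linear; eassumption.
Qed.

Lemma lt_le_trans a b c : a ≺ b -> b ≼ c -> a ≺ c.
Proof.
  intros [H1 H2] H3; split; [eapply le_trans; eassumption|].
  intros ->; apply H2, le_antisym; assumption.
Qed.

Lemma le_lt_trans a b c : a ≼ b -> b ≺ c -> a ≺ c.
Proof.
  intros H1 [H2 H3]; split; [eapply le_trans; eassumption|].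
  intros ->; apply H3, le_antisym; assumption.
Qed.

Lemma level_spec a : is_level le a (ell a).
Proof.
  apply (epsilon_spec (inhabits 0) (fun n => is_level le a n)).
  destruct (proj1 (proj2 (proj2 (proj2 (proj1 (proj1 HT))))) a) as [l Hl].
  destruct (NoDup_exists l) as (l' & Hd & Hl').
  exists (length l'), l'; split; [assumption|split; [|reflexivity]].
  intros b; rewrite Hl; apply Hl'.
Qed.

Lemma lt_level a b : a ≺ b -> ell a < ell b.
Proof.
  intros H.
  destruct (level_spec a) as (la & Hda & Hla & <-).
  destruct (level_spec b) as (lb & Hdb & Hlb & <-).
  change (length (a :: la) <= length lb).
  apply NoDup_incl_length.
  - constructor; [|assumption]. intros Ha; apply Hla in Ha; apply Ha; reflexivity.
  - intros x [<-|Hx]; apply Hlb; [assumption|].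
    apply Hla in Hx; eapply lt_le_trans; [eassumption|apply H].
Qed.

Lemma le_level_eq a b : a ≼ b -> ell b <= ell a -> a = b.
Proof.
  intros H Hl; destruct (le_lt_or_eq _ _ H) as [H'| ->]; [|reflexivity].
  apply lt_level in H'; lia.
Qed.

Lemma anc_unique a a' b : a ≼ b -> a' ≼ b -> ell a = ell a' -> a = a'.
Proof.
  intros H H' E; destruct (le_linear _ _ _ H H') as [L|L].
  - apply le_level_eq; [assumption|lia].
  - symmetry; apply le_level_eq; [assumption|lia].
Qed.

Lemma list_max_level (l : list T) :
  l <> [] -> exists b, In b l /\ forall c, In c l -> ell c <= ell b.
Proof.
  induction l as [|x l IH]; [congruence|intros _].
  destruct l as [|y l].
  - exists x; split; [simpl; auto|intros c [<-|[]]; lia].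
  - destruct IH as (b & Hb & Hmax); [discriminate|].
    destruct (Nat.le_gt_cases (ell x) (ell b)).
    + exists b; split; [right; assumption|intros c [<-|Hc]; auto].
    + exists x; split; [left; reflexivity|].
      intros c [<-|Hc]; [lia|]; specialize (Hmax c Hc); lia.
Qed.

Lemma imm_pred a n : ell a = S n -> exists b, imm_succ le b a /\ ell b = n.
Proof.
  intros E; destruct (level_spec a) as (la & Hda & Hla & Hlen).
  destruct (list_max_level la) as (b & Hb & Hmax).
  { intros ->; simpl in Hlen; lia. }
  apply Hla in Hb; exists b; split.
  - split; [assumption|]; intros (c & Hbc & Hca).
    apply Hla, Hmax in Hca; apply lt_level in Hbc; lia.
  - destruct (level_spec b) as (lb & Hdb & Hlb & Hlenb).
    assert (length la <= length (b :: lb)).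
    { apply NoDup_incl_length; [assumption|]; intros c Hc.
      assert (Hca := proj2 (Hla c) Hc).
      destruct (classic (b = c)) as [->|Hn]; [simpl; auto|right; apply Hlb].
      split; [|congruence].
      destruct (lt_linear _ _ _ Hb Hca) as [H|H]; [|assumption].
      exfalso; apply Hn, le_level_eq; auto. }
    apply lt_level in Hb; simpl in *; lia.
Qed.

Lemma imm_succ_level a b : imm_succ le a b -> ell b = S (ell a).
Proof.
  intros [Hab Hn]; assert (Hl := lt_level _ _ Hab).
  destruct (ell b) as [|n] eqn:E; [lia|].
  destruct (imm_pred b n E) as (b' & [Hb' Hn'] & <-).
  destruct (lt_linear _ _ _ Hab Hb') as [H|H];
    destruct (le_lt_or_eq _ _ H) as [H'|H']; subst; auto; exfalso; eauto.
Qed.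

Lemma imm_succ_intro a b : a ≼ b -> ell b = S (ell a) -> imm_succ le a b.
Proof.
  intros H E; split.
  - split; [assumption|]; intros ->; lia.
  - intros (c & H1 & H2); apply lt_level in H1, H2; lia.
Qed.

Lemma anc_exists b i : i <= ell b -> exists a, a ≼ b /\ ell a = i.
Proof.
  remember (ell b - i) as d eqn:Ed; revert b Ed.
  induction d as [|d IH]; intros b Ed Hi.
  - exists b; split; [apply le_refl|lia].
  - destruct (imm_pred b (ell b - 1)) as (b' & Hb & El); [lia|].
    destruct (IH b') as (a & Ha & Ea); [lia|lia|].
    exists a; split; [eapply le_trans; [eassumption|apply Hb]|assumption].
Qed.

Lemma Ssucc_imm a p c b : Ssucc a p c = Some b -> imm_succ le a b.
Proof. intros H; apply (proj1 (proj2 (proj2 (proj2 (proj2 (proj1 HT)))))) in H; apply H. Qed.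

Lemma Ssucc_args a p c b q : Ssucc a p c = Some b -> In q p -> ell q < ell a.
Proof. intros H; apply (proj1 (proj2 (proj2 (proj2 (proj2 (proj1 HT)))))) in H; apply H. Qed.

Lemma Ssucc_exists a b : imm_succ le a b -> exists p c, Ssucc a p c = Some b.
Proof. apply (proj2 (proj2 (proj2 (proj2 (proj2 (proj2 (proj1 HT))))))). Qed.

Lemma levels_finite n : exists l : list T, forall a, ell a <= n -> In a l.
Proof.
  induction n as [|n [l Hl]].
  - destruct (proj1 (proj2 (proj2 (proj2 (proj1 HT))))) as [l Hl].
    exists l; intros a Ha; apply Hl; lia.
  - assert (Hs : exists l', forall a b, In a l -> imm_succ le a b -> In b l').
    { clear Hl; induction l as [|x l [l' IH]].
      - exists []; intros a b [].
      - destruct (proj1 (proj2 (proj2 (proj1 HT))) x) as [lx Hlx].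
        exists (lx ++ l'); intros a b [->|Ha] Hab; apply in_or_app.
        + left; apply Hlx, Hab.
        + right; eapply IH; eassumption. }
    destruct Hs as [l' Hl']; exists (l ++ l'); intros a Ha; apply in_or_app.
    destruct (Nat.le_gt_cases (ell a) n) as [H|H]; [auto|right].
    destruct (imm_pred a n) as (b & Hb & El); [lia|].
    apply (Hl' b); [apply Hl; lia|assumption].
Qed.

(** A map that skips only level [m] hits every other level, so two maps from (M3) with different [m]
    account for all levels. *)
Lemma level_inhabited n : exists a, ell a = n.
Proof.
  assert (H3 := proj2 (proj2 (proj2 (proj2 (proj2 (proj2 HT)))))).
  destruct (Nat.eq_dec n 1) as [->|Hn].
  - destruct (H3 0 2) as (F & _ & HF & _); [lia|].
    destruct (proj2 (HF 1)) as [a Ha]; [lia|exists (F a); assumption].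
  - destruct (H3 0 1) as (F & _ & HF & _); [lia|].
    destruct (proj2 (HF n)) as [a Ha]; [lia|exists (F a); assumption].
Qed.

(** * Maps in [M] and the functions they induce on levels *)

Lemma M_shape F : M F -> shape_preserving le Ssucc F.
Proof. apply HT. Qed.

Lemma M_level F a b : M F -> ell a = ell b -> ell (F a) = ell (F b).
Proof. intros HF; apply (M_shape F HF). Qed.

Lemma M_Ssucc F a p c b : M F -> Ssucc a p c = Some b ->
  exists b', Ssucc (F a) (map F p) c = Some b' /\ b' ≼ F b.
Proof. intros HF; apply (M_shape F HF). Qed.

Lemma M_root F a b : M F -> ell a = 0 -> a ≼ b -> a ≼ F b.
Proof. intros HF; apply (M_shape F HF). Qed.

(** By condition (ii), the image of an immediate successor of a node lies above an immediate
    successor of the image; the rest is induction on the level of [b]. *)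
Lemma M_lt F a b : M F -> a ≺ b -> F a ≺ F b.
Proof.
  intros HF; remember (ell b) as n eqn:E; revert b E.
  induction n as [|n IH]; intros b E Hab.
  - apply lt_level in Hab; lia.
  - destruct (imm_pred b n (eq_sym E)) as (b' & Hb' & El).
    assert (Hlt : F b' ≺ F b).
    { destruct (Ssucc_exists _ _ Hb') as (p & c & HS).
      destruct (M_Ssucc F _ _ _ _ HF HS) as (x & Hx & Hle).
      apply Ssucc_imm in Hx; eapply lt_le_trans; [apply Hx|assumption]. }
    destruct (classic (a = b')) as [->|Hn]; [assumption|].
    eapply le_lt_trans; [|exact Hlt].
    apply IH; [auto|]; split; [|assumption].
    destruct (lt_linear _ _ _ Hab (proj1 Hb')) as [H|H]; [assumption|].
    exfalso; apply (proj2 Hb'); exists a; split; [split; auto|assumption].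
Qed.

Lemma M_le F a b : M F -> a ≼ b -> F a ≼ F b.
Proof.
  intros HF H; destruct (le_lt_or_eq _ _ H) as [H'| ->]; [|apply le_refl].
  apply M_lt; assumption.
Qed.

Lemma M_id : M (fun x => x).
Proof. apply HT. Qed.

Lemma M_comp F G : M F -> M G -> M (fun x => F (G x)).
Proof. apply HT. Qed.

Definition tilde (F : T -> T) (n : nat) : nat :=
  epsilon (inhabits 0) (fun m => exists a, ell a = n /\ ell (F a) = m).

Lemma level_M F a : M F -> ell (F a) = tilde F (ell a).
Proof.
  intros HF.
  assert (H : exists b, ell b = ell a /\ ell (F b) = tilde F (ell a)).
  { apply (epsilon_spec (inhabits 0) (fun m => exists b, ell b = ell a /\ ell (F b) = m)).
    exists (ell (F a)), a; auto. }
  destruct H as (b & E & <-); apply M_level; auto.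
Qed.

Lemma tilde_lt F i j : M F -> i < j -> tilde F i < tilde F j.
Proof.
  intros HF Hij; destruct (level_inhabited j) as [b <-].
  destruct (anc_exists b i) as (a & Ha & <-); [lia|].
  rewrite <- !level_M by assumption; apply lt_level, M_lt; [assumption|].
  split; [assumption|intros ->; lia].
Qed.

Lemma tilde_le F i j : M F -> i <= j -> tilde F i <= tilde F j.
Proof.
  intros HF H; destruct (Nat.eq_dec i j) as [->|]; [lia|].
  apply Nat.lt_le_incl, tilde_lt; [assumption|lia].
Qed.

Lemma tilde_ge F n : M F -> n <= tilde F n.
Proof.
  intros HF; induction n as [|n IH]; [lia|].
  assert (H := tilde_lt F n (S n) HF); lia.
Qed.

Lemma tilde_inj F i j : M F -> tilde F i = tilde F j -> i = j.
Proof.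
  intros HF E; destruct (Nat.lt_trichotomy i j) as [H|[H|H]]; auto;
    apply (tilde_lt F) in H; auto; lia.
Qed.

Lemma tilde_comp F G n : M F -> M G -> tilde (fun x => F (G x)) n = tilde F (tilde G n).
Proof.
  intros HF HG; destruct (level_inhabited n) as [a <-].
  rewrite <- (level_M (fun x => F (G x))), <- !level_M by auto using M_comp.
  reflexivity.
Qed.

Lemma tilde_id n : tilde (fun x => x) n = n.
Proof.
  destruct (level_inhabited n) as [a <-].
  symmetry; apply (level_M (fun x => x)), M_id.
Qed.

Definition eqon (n : nat) (F G : T -> T) : Prop := forall a, ell a <= n -> F a = G a.

Lemma tilde_eqon F G n i : M F -> M G -> eqon n F G -> i <= n -> tilde F i = tilde G i.
Proof.
  intros HF HG E Hi; destruct (level_inhabited i) as [a <-].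
  rewrite <- !level_M by assumption; rewrite E; auto.
Qed.

Local Notation "M^ n" := (M_from le M n) (at level 1, n at level 0).

Lemma M_from_id n : M^n (fun x => x).
Proof. split; [apply M_id|reflexivity]. Qed.

Lemma M_from_comp n F G : M^n F -> M^n G -> M^n (fun x => F (G x)).
Proof.
  intros [HF EF] [HG EG]; split; [apply M_comp; assumption|].
  intros a Ha; rewrite EG; auto.
Qed.

Lemma M_from_weaken m n F : m <= n -> M^n F -> M^m F.
Proof. intros H [HF E]; split; [assumption|]; intros a Ha; apply E; lia. Qed.

Lemma tilde_from n F i : M^n F -> i < n -> tilde F i = i.
Proof.
  intros [HF E] Hi; destruct (level_inhabited i) as [a <-].
  rewrite <- level_M, E; auto.
Qed.

(** Write [b] as the successor of [a] with data [p], [c]. All of [a] and [p] lies below level [n]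
    and is fixed by [F], so condition (ii) places [F b] above this same successor. *)
Lemma M_from_le n F b : M^n F -> ell b <= n -> b ≼ F b.
Proof.
  intros [HF E] Hb; destruct (ell b) as [|k] eqn:Eb.
  - apply M_root; auto using le_refl.
  - destruct (imm_pred b k Eb) as (a & Ha & El).
    destruct (Ssucc_exists _ _ Ha) as (p & c & HS).
    destruct (M_Ssucc F _ _ _ _ HF HS) as (x & Hx & Hle).
    rewrite E in Hx by lia.
    rewrite (map_ext_in F (fun x => x)), map_id, HS in Hx.
    + injection Hx as <-; assumption.
    + intros q Hq; apply E; apply (Ssucc_args _ _ _ _ _ HS) in Hq; lia.
Qed.

Lemma M_from_eqon_id n F : M^n F -> tilde F n = n -> eqon n F (fun x => x).
Proof.
  intros HF E a Ha; symmetry; apply le_level_eq; [eapply M_from_le; eassumption|].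
  rewrite level_M by apply HF.
  destruct (Nat.eq_dec (ell a) n) as [->|]; [lia|].
  rewrite (tilde_from n F); auto; lia.
Qed.

Lemma M_from_intro F n : M F -> (forall i, i < n -> tilde F i = i) -> M^n F.
Proof.
  induction n as [|n IH]; intros HF H.
  - split; [assumption|intros; lia].
  - assert (Hn : M^n F) by (apply IH; auto).
    split; [assumption|]; intros a Ha; apply (M_from_eqon_id n F); auto; lia.
Qed.

(** * Factorizations of maps in [M] *)

Lemma skips_only_from F m : M F -> skips_only le F m -> M^m F /\ tilde F m = S m.
Proof.
  intros HF Hs.
  assert (Hhit : forall j, j <> m -> exists i, tilde F i = j).
  { intros j Hj; apply Hs in Hj as [a Ha]; exists (ell a).
    rewrite <- level_M; assumption. }
  assert (Hne : forall i, tilde F i <> m).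
  { intros i; destruct (level_inhabited i) as [a <-].
    rewrite <- level_M by assumption; apply Hs; exists a; reflexivity. }
  assert (Hlow : forall i, i < m -> tilde F i = i).
  { induction i as [i IH] using lt_wf_ind; intros Hi.
    destruct (Hhit i) as [k Hk]; [lia|].
    assert (Hki := tilde_ge F k HF).
    destruct (Nat.eq_dec k i) as [->|]; [assumption|].
    rewrite IH in Hk; lia. }
  split; [apply M_from_intro; assumption|].
  (* The level [k] sent to [S m] is [m]: lower levels are fixed, and if [k > m], then level [m]
     would have to go to the skipped level [m]. *)
  destruct (Hhit (S m)) as [k Hk]; [lia|].
  assert (H1 := tilde_ge F k HF); assert (H2 := tilde_ge F m HF); assert (H3 := Hne m).
  destruct (Nat.lt_trichotomy k m) as [H|[->|H]]; [|assumption|].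
  - rewrite Hlow in Hk; lia.
  - apply (tilde_lt F _ _ HF) in H; lia.
Qed.

Lemma M_copy n m : n < m -> exists F, M^m F /\ tilde F m = S m /\
  forall a b p c s, ell a = n -> ell b = m -> Ssucc a p c = Some s -> s ≼ b ->
    Ssucc b p c = Some (F b).
Proof.
  intros H; destruct (proj2 (proj2 (proj2 (proj2 (proj2 (proj2 HT))))) n m H)
    as (F & HF & Hs & HS).
  apply skips_only_from in Hs as [H1 H2]; [|assumption].
  exists F; auto.
Qed.

(* Iterating (M2) removes the skipped levels [m0], ..., [tilde F n - 1] one by one. *)
Lemma M_decompose F n m0 :
  M F -> (forall i, i < n -> tilde F i < m0) -> m0 <= tilde F n ->
  exists H F1, M^m0 H /\ M F1 /\ tilde F1 n = m0 /\
    eqon n F (fun a => H (F1 a)) /\ forall a, ell a < n -> F1 a = F a.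
Proof.
  remember (tilde F n - m0) as d eqn:Ed; revert F Ed.
  induction d as [|d IH]; intros F Ed HF Hlow Hm.
  - exists (fun x => x), F; repeat split; auto using M_id; try (intros ? ?; reflexivity).
    lia.
  - destruct (level_inhabited n) as [a Ha].
    assert (El : ell (F a) = tilde F n) by (rewrite level_M, Ha; auto).
    destruct (proj1 (proj2 (proj2 (proj2 (proj2 (proj2 HT))))) n F a HF Ha)
      as (F1 & F2 & HF1 & HF2 & Hs & E).
    { lia. }
    { intros [b Hb]; rewrite level_M, El in Hb by assumption.
      destruct (Nat.lt_ge_cases (ell b) n) as [H|H].
      - apply Hlow in H; lia.
      - apply (tilde_le F _ _ HF) in H; lia. }
    rewrite El in Hs; apply skips_only_from in Hs as [HF2' Ht2]; [|assumption].
    assert (Et1 : tilde F1 n = tilde F n - 1).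
    { apply (tilde_inj F2); [assumption|]; rewrite Ht2.
      rewrite <- tilde_comp by assumption.
      rewrite (tilde_eqon _ F n n); auto using M_comp; lia. }
    assert (E1 : forall b, ell b < n -> F1 b = F b).
    { intros b Hb; rewrite <- E by lia; symmetry; apply HF2'.
      rewrite level_M, <- Et1 by assumption; apply tilde_lt; assumption. }
    destruct (IH F1) as (H & G & HH & HG & Et & EH & EG); auto; try lia.
    { intros i Hi; destruct (level_inhabited i) as [b <-].
      rewrite <- level_M, E1, level_M by auto; auto. }
    exists (fun x => F2 (H x)), G; repeat split; auto.
    + apply M_comp; [assumption|apply HH].
    + intros b Hb; rewrite (proj2 HH), (proj2 HF2'); auto; lia.
    + intros b Hb; rewrite <- E, EH; auto.
    + intros b Hb; rewrite EG, E1; auto.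
Qed.

(** Factoring at level [S n] strips off the gap after [tilde F n] without touching [F] up to level
    [n]. *)
Lemma M_normalize F n : M F ->
  exists w, M w /\ eqon n w F /\ tilde w (S n) = S (tilde F n).
Proof.
  intros HF; destruct (M_decompose F (S n) (S (tilde F n))) as (_ & w & _ & Hw & Et & _ & E).
  - assumption.
  - intros i Hi; apply Nat.lt_succ_r, tilde_le; [assumption|lia].
  - apply tilde_lt; auto.
  - exists w; repeat split; auto; intros a Ha; apply E; lia.
Qed.

Lemma M_from_normalize F n l : l <= S n -> M^l F ->
  exists w, M^l w /\ eqon n w F /\ tilde w n = tilde F n /\ tilde w (S n) = S (tilde w n).
Proof.
  intros Hl HF; destruct (M_normalize F n (proj1 HF)) as (w & Hw & E & Et).
  assert (E' : tilde w n = tilde F n) by (eapply tilde_eqon; eauto; apply HF).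
  exists w; repeat split; auto; try congruence.
  intros a Ha; rewrite E by lia; apply HF, Ha.
Qed.

Lemma M_split g n m : M^n g -> n <= m -> m <= tilde g n ->
  exists g' e, M^n g' /\ M^m e /\ tilde g' n = m /\ tilde e m = tilde g n /\
    eqon n g (fun a => e (g' a)).
Proof.
  intros Hg Hnm Hm.
  destruct (M_decompose g n m) as (e & g' & He & Hg' & Et & E & E'); auto.
  - apply Hg.
  - intros i Hi; rewrite (tilde_from n); auto; lia.
  - exists g', e; repeat split; auto.
    + intros a Ha; rewrite E' by assumption; apply Hg, Ha.
    + apply He.
    + apply He.
    + rewrite <- Et at 1; rewrite <- tilde_comp by (auto; apply He).
      symmetry; apply (tilde_eqon _ _ n); auto; [apply Hg|].
      apply M_comp; [apply He|assumption].
Qed.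

(** Transports [g] from level [l] to level [tilde F l]. Decompose [F o g] at that level: the inner
    factor agrees with [F] on level [l], since both values lie below [F (g a)] at the same level. *)
Lemma M_cone F g l : M F -> M^l g ->
  exists h, M^(tilde F l) h /\ tilde h (tilde F l) = tilde F (tilde g l) /\
    eqon l (fun a => F (g a)) (fun a => h (F a)).
Proof.
  intros HF Hg.
  assert (HFg : M (fun a => F (g a))) by (apply M_comp; [assumption|apply Hg]).
  assert (Etc : forall i, tilde (fun a => F (g a)) i = tilde F (tilde g i))
    by (intros i; apply tilde_comp; [assumption|apply Hg]).
  destruct (M_decompose (fun a => F (g a)) l (tilde F l)) as (h & F1 & Hh & HF1 & Et & E & E').
  - assumption.
  - intros i Hi; rewrite Etc, (tilde_from l g) by auto; apply tilde_lt; assumption.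
  - rewrite Etc; apply tilde_le; [assumption|apply tilde_ge, Hg].
  - assert (E1 : eqon l F1 F).
    { intros a Ha; destruct (Nat.eq_dec (ell a) l) as [Hl|Hl].
      - apply (anc_unique _ _ (F (g a))).
        + rewrite E by assumption; apply (M_from_le (tilde F l)); [assumption|].
          rewrite level_M, Hl, Et by assumption; reflexivity.
        + apply M_le; [assumption|]; eapply M_from_le; eassumption.
        + rewrite !level_M, Hl, Et by assumption; reflexivity.
      - rewrite E' by lia; rewrite (proj2 Hg) by lia; reflexivity. }
    exists h; repeat split.
    + apply Hh.
    + apply Hh.
    + rewrite <- Et at 1; rewrite <- tilde_comp by (auto; apply Hh).
      rewrite <- Etc; symmetry; apply (tilde_eqon _ _ l); auto.
      apply M_comp; [apply Hh|assumption].
    + intros a Ha; rewrite E, E1 by assumption; reflexivity.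
Qed.

(** Levels are finite, so a restriction to levels up to [n] is a vector over a finite set; one map
    is kept for each vector that occurs. *)
Lemma finite_representatives (P : (T -> T) -> Prop) n m :
  exists L : list (T -> T), (forall F, In F L -> P F) /\
    forall F, P F -> (forall a, ell a <= n -> ell (F a) <= m) ->
      exists G, In G L /\ eqon n F G.
Proof.
  destruct (levels_finite n) as [D HD]; destruct (levels_finite m) as [E HE].
  assert (H : forall V, exists L : list (T -> T), (forall F, In F L -> P F) /\
    forall F, P F -> In (map F (filter (fun a => ell a <=? n) D)) V ->
      exists G, In G L /\ eqon n F G).
  { induction V as [|x V (L & HL1 & HL2)].
    - exists []; split; [intros F []|intros F _ []].
    - destruct (classic (exists F, P F /\ map F (filter (fun a => ell a <=? n) D) = x))
        as [(F0 & HF0 & Ex)|Hn].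
      + exists (F0 :: L); split; [intros F [<-|HF]; auto|].
        intros F HF [Ex'|HV].
        * exists F0; split; [simpl; auto|]; intros a Ha.
          rewrite Ex' in Ex; symmetry.
          apply (proj1 (@map_ext_in_iff _ _ F0 F _) Ex).
          apply filter_In; split; [auto|apply Nat.leb_le, Ha].
        * destruct (HL2 F HF HV) as (G & HG & EG); exists G; simpl; auto.
      + exists L; split; [assumption|]; intros F HF [Ex|HV]; [|auto].
        exfalso; apply Hn; exists F; auto. }
  destruct (H (vecs E (length (filter (fun a => ell a <=? n) D)))) as (L & HL1 & HL2).
  exists L; split; [assumption|]; intros F HF HFm; apply HL2; [assumption|].
  apply in_vecs; split; [apply length_map|].
  intros b Hb; apply in_map_iff in Hb as [a [<- Ha]].
  apply filter_In in Ha as [_ Ha]; apply Nat.leb_le in Ha; auto.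
Qed.

(** * Limits and fusion *)

Lemma M_limit b (Fs : nat -> T -> T) :
  (forall i, M (Fs i)) -> (forall i a, ell a < b + i -> Fs (S i) a = Fs i a) ->
  exists F, M F /\ forall i a, ell a < b + i -> F a = Fs i a.
Proof.
  intros HM HE.
  destruct (proj1 (proj2 (proj2 (proj2 (proj2 HT)))) (fun i => Fs (S i))) as (F & HF & EF).
  - auto.
  - intros i a Ha; symmetry; apply HE; lia.
  - exists F; split; [assumption|].
    assert (Hd : forall d i a, ell a < b + i -> Fs (d + i) a = Fs i a).
    { induction d as [|d IH]; intros i a Ha; simpl; [reflexivity|].
      rewrite HE by lia; apply IH, Ha. }
    intros i a Ha; rewrite (EF (ell a + i)) by lia.
    apply (Hd (S (ell a))); assumption.
Qed.

Lemma M_from_limit n b (Fs : nat -> T -> T) :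
  n <= b -> (forall i, M^n (Fs i)) ->
  (forall i a, ell a < b + i -> Fs (S i) a = Fs i a) ->
  exists F, M^n F /\ forall i a, ell a < b + i -> F a = Fs i a.
Proof.
  intros Hnb HM HE; destruct (M_limit b Fs) as (F & HF & EF); auto.
  { intros i; apply HM. }
  exists F; split; [|assumption]; split; [assumption|].
  intros a Ha; rewrite (EF 0) by lia; apply HM, Ha.
Qed.

(** Each stage composes on the right with a map that is the identity below level [b + i], so the
    stages converge. Up to a given level the limit equals a later stage, which is the map of stage
    [i] followed on the right by the finitely many factors in between. *)
Lemma fusion n b (D : nat -> (T -> T) -> Prop) :
  n <= b ->
  (forall i P, M^n P -> exists Q, M^(b + i) Q /\ D i (fun x => P (Q x))) ->
  exists K, M^n K /\ forall i m, exists P Q,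
    M^n P /\ D i P /\ M^(S (b + i)) Q /\ eqon m K (fun x => P (Q x)).
Proof.
  intros Hnb Hstep.
  destruct (dependent_choice (fun _ P => M^n P)
    (fun i P P' => D i P' /\ exists Q, M^(b + i) Q /\ P' = fun x => P (Q x)) (fun x => x))
    as (Ks & _ & HK).
  - apply M_from_id.
  - intros i P HP; destruct (Hstep i P HP) as (Q & HQ & HD).
    exists (fun x => P (Q x)); repeat split; eauto.
    + apply (M_from_comp n P Q); [assumption|eapply M_from_weaken; [|eassumption]; lia].
    + apply M_from_comp; [assumption|eapply M_from_weaken; [|eassumption]; lia].
  - destruct (M_from_limit n b Ks) as (K & HKM & HKE); auto.
    { intros i; apply HK. }
    { intros i a Ha; destruct (HK i) as (_ & _ & Q & HQ & ->).
      f_equal; apply HQ, Ha. }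
    exists K; split; [assumption|]; intros i m; exists (Ks (S i)).
    assert (Hd : forall d, exists Q, M^(S (b + i)) Q /\
              Ks (d + S i) = fun x => Ks (S i) (Q x)).
    { induction d as [|d (Q & HQ & E)].
      - exists (fun x => x); split; [apply M_from_id|reflexivity].
      - destruct (HK (d + S i)) as (_ & _ & Q' & HQ' & E').
        exists (fun x => Q (Q' x)); split.
        + apply M_from_comp; [assumption|eapply M_from_weaken; [|eassumption]; lia].
        + simpl; rewrite E', E; reflexivity. }
    destruct (Hd (S m)) as (Q & HQ & E); exists Q; repeat split.
    + apply HK.
    + apply HK.
    + apply HK.
    + apply HQ.
    + apply HQ.
    + intros a Ha; rewrite (HKE (S m + S i)), E by lia; reflexivity.
Qed.

(** * Words *)


(** Only the action on level [l] is used as a letter: it chooses for each [a] there the data [p],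
    [c] of an immediate successor, which can be taken again above any image of [a]. *)
Definition letter (l : nat) (e : T -> T) : Prop := M^l e /\ tilde e l = S l.

(* The last letter added is the head of [u]. *)
Fixpoint code (l : nat) (u : list (T -> T)) (z : T -> T) : Prop :=
  match u with
  | [] => forall a, ell a = l -> z a = a
  | e :: u' => exists z', code l u' z' /\
      forall a p c, ell a = l -> Ssucc a p c = Some (e a) ->
        Ssucc (z' a) p c = Some (z a)
  end.

Lemma letter_succ l e a : letter l e -> ell a = l ->
  exists p c, Ssucc a p c = Some (e a).
Proof.
  intros [He Et] Ha; apply Ssucc_exists, imm_succ_intro.
  - apply (M_from_le l); auto; lia.
  - rewrite level_M, Ha by apply He; assumption.
Qed.

Lemma code_unique l u z z' : Forall (letter l) u -> code l u z -> code l u z' ->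
  forall a, ell a = l -> z a = z' a.
Proof.
  revert z z'; induction u as [|e u IH]; intros z z' Hu Hz Hz' a Ha; simpl in *.
  - rewrite Hz, Hz'; auto.
  - inversion_clear Hu as [|? ? He Hu'].
    destruct Hz as (y & Hy & Ey), Hz' as (y' & Hy' & Ey').
    destruct (letter_succ l e a He Ha) as (p & c & HS).
    assert (E1 := Ey _ _ _ Ha HS); assert (E2 := Ey' _ _ _ Ha HS).
    rewrite (IH y y') in E1 by auto; congruence.
Qed.

Lemma code_level l u z : Forall (letter l) u -> code l u z ->
  forall a, ell a = l -> ell (z a) = l + length u.
Proof.
  revert z; induction u as [|e u IH]; intros z Hu Hz a Ha; simpl in *.
  - rewrite Hz; auto; lia.
  - inversion_clear Hu as [|? ? He Hu']; destruct Hz as (y & Hy & Ey).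
    destruct (letter_succ l e a He Ha) as (p & c & HS).
    apply Ey in HS; [|assumption].
    apply Ssucc_imm, imm_succ_level in HS.
    rewrite HS, (IH y); auto; lia.
Qed.

Lemma code_ext l u z z' : (forall a, ell a = l -> z a = z' a) -> code l u z -> code l u z'.
Proof.
  intros E; destruct u as [|e u]; simpl.
  - intros H a Ha; rewrite <- E; auto.
  - intros (y & Hy & Ey); exists y; split; [assumption|].
    intros a p c Ha; rewrite <- E; auto.
Qed.

(** Since [w] fixes [p], the node [w (e a)] lies above the successor of [w a] with the same data as
    [e a]; having no gap after [tilde w l] makes the two equal. *)
Lemma code_cons l u w e : M^l w -> tilde w (S l) = S (tilde w l) ->
  letter l e -> code l u w -> code l (e :: u) (fun a => w (e a)).
Proof.
  intros Hw Ew [He Et] Hu; exists w; split; [assumption|].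
  intros a p c Ha HS.
  destruct (M_Ssucc w _ _ _ _ (proj1 Hw) HS) as (b & Hb & Hle).
  rewrite (map_ext_in w (fun x => x)), map_id in Hb.
  - rewrite Hb; f_equal; apply le_level_eq; [assumption|].
    apply Ssucc_imm, imm_succ_level in Hb.
    rewrite Hb, !level_M, Ha, Et, Ew by (apply Hw || apply He); lia.
  - intros q Hq; apply Hw; apply (Ssucc_args _ _ _ _ _ HS) in Hq; lia.
Qed.

(** Each occurrence of a letter leaves below [z a] a successor with the data of that letter, at a
    level given by its position. This is what (M3) copies. *)
Lemma code_find l x e y z : Forall (letter l) (x ++ e :: y) -> code l (x ++ e :: y) z ->
  forall a p c, ell a = l -> Ssucc a p c = Some (e a) ->
  exists a' s, ell a' = l + length y /\ Ssucc a' p c = Some s /\ s ≼ z a.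
Proof.
  revert z; induction x as [|f x IH]; intros z Hu Hz a p c Ha HS; simpl in *;
    inversion_clear Hu as [|? ? Hf Hu']; destruct Hz as (z' & Hz' & E).
  - exists (z' a), (z a); split; [|split; [auto|apply le_refl]].
    eapply code_level; eassumption.
  - destruct (IH z' Hu' Hz' a p c Ha HS) as (a' & s & H1 & H2 & H3).
    exists a', s; repeat split; auto.
    destruct (letter_succ l f a Hf Ha) as (p' & c' & HS').
    apply E in HS'; [|assumption]; apply Ssucc_imm in HS'.
    eapply le_trans; [eassumption|apply HS'].
Qed.

Lemma word_exists l u : Forall (letter l) u ->
  exists w, M^l w /\ tilde w l = l + length u /\ tilde w (S l) = S (tilde w l) /\ code l u w.
Proof.
  induction u as [|e u IH]; intros Hu.
  - exists (fun x => x); rewrite !tilde_id; simpl.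
    repeat split; try reflexivity; [apply M_id|lia].
  - inversion_clear Hu as [|? ? He Hu'].
    destruct (IH Hu') as (w & Hw & Et & En & Hc).
    destruct (M_from_normalize (fun a => w (e a)) l l) as (w' & Hw' & E & Et' & En').
    + lia.
    + apply M_from_comp; [assumption|apply He].
    + exists w'; repeat split; auto; try apply Hw'.
      * rewrite Et', tilde_comp, (proj2 He), En, Et by (apply Hw || apply He).
        simpl; lia.
      * apply (code_ext _ _ (fun a => w (e a))).
        -- intros a Ha; symmetry; apply E; lia.
        -- apply code_cons; auto.
Qed.

(* (M3) only copies letters, so constant letters are available from the point on where
   they have occurred, hence the block [u0] containing all of them. *)
Lemma left_variable_word_realized l es u0 s w v :
  Forall (letter l) es -> Forall (letter l) (s ++ u0) -> incl es u0 -> letters_in es v ->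
  M^l w -> tilde w l = l + length (s ++ u0) -> tilde w (S l) = S (tilde w l) ->
  code l (s ++ u0) w ->
  exists h, M^(S (tilde w l)) h /\
    forall e, In e es -> code l (subst e v ++ e :: s ++ u0) (fun a => h (w (e a))).
Proof.
  intros Hes Hsu Hin Hv Hw Et En Hc; induction v as [|o v IH].
  - exists (fun x => x); split; [apply M_from_id|].
    intros e He; apply code_cons; auto.
    rewrite Forall_forall in Hes; auto.
  - destruct IH as (h & Hh & Hch).
    { intros b Hb; apply Hv; simpl; auto. }
    set (m := l + S (length v + length (s ++ u0))).
    assert (Hlet : forall e, In e es -> Forall (letter l) (subst e v ++ e :: s ++ u0)).
    { intros e He; rewrite Forall_forall in Hes |- *; intros x Hx.
      apply in_app_or in Hx as [Hx|[<-|Hx]]; auto.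
      - apply Hes; apply (subst_incl es e v) in Hx; auto.
        intros b Hb; apply Hv; simpl; auto.
      - rewrite Forall_forall in Hsu; auto. }
    (* One map from (M3) serves all [e] at once, because the level [l + length y] of the occurrence
       to be copied is the same for every [e]. *)
    assert (Hcopy : forall y (f : (T -> T) -> (T -> T)), length y <= length (s ++ u0) ->
      (forall e, In e es -> exists x, subst e v ++ e :: s ++ u0 = x ++ f e :: y) ->
      exists h', M^(S (tilde w l)) h' /\ forall e, In e es ->
        code l (f e :: subst e v ++ e :: s ++ u0) (fun a => h' (w (e a)))).
    { intros y f Hy Hf.
      destruct (M_copy (l + length y) m) as (F & HF & _ & HFS); [lia|].
      exists (fun a => F (h a)); split.
      - apply M_from_comp; [|assumption].
        eapply M_from_weaken; [|eassumption]; unfold m; lia.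
      - intros e He; exists (fun a => h (w (e a))); split; [auto|].
        intros a p c Ha HS; destruct (Hf e He) as [x Ex].
        assert (H1 := Hch e He); assert (H2 := Hlet e He).
        assert (Hl := code_level _ _ _ H2 H1 a Ha).
        rewrite Ex in H1, H2.
        destruct (code_find _ _ _ _ _ H2 H1 a p c Ha HS) as (a' & b & Ha' & Hb & Hle).
        apply (HFS a' _ p c b); auto.
        rewrite Hl, length_app, length_subst; simpl; unfold m; lia. }
    destruct o as [b|]; simpl.
    + destruct (in_split b u0) as (y1 & y2 & Eu).
      { apply Hin, Hv; simpl; auto. }
      apply (Hcopy y2 (fun _ => b)).
      * rewrite Eu, !length_app; simpl; lia.
      * intros e _; exists (subst e v ++ e :: s ++ y1).
        rewrite Eu, <- !app_assoc; simpl; rewrite <- app_assoc; reflexivity.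
    (* The variable is copied from its first occurrence, directly after [s ++ u0]; the left variable
       form guarantees this occurrence. *)
    + apply (Hcopy (s ++ u0) (fun e => e)); [lia|].
      intros e _; exists (subst e v); reflexivity.
Qed.

(** [C] is a relation because a map may admit several colours; [c] picks one for each word. Letters
    are reduced to finitely many representatives [es], and every word begins with the block [es] so
    that (M3) can repeat each of them. *)
Lemma monochromatic_left_variable l {X : Type} (C : (T -> T) -> X -> Prop) (L : list X) :
  (forall z z' x, eqon l z z' -> C z x -> C z' x) ->
  (forall z, M^l z -> exists x, In x L /\ C z x) ->
  exists w h x, M^l w /\ tilde w (S l) = S (tilde w l) /\ M^(S (tilde w l)) h /\
    C w x /\ forall e, letter l e -> C (fun a => h (w (e a))) x.
Proof.
  intros Hext HC.
  destruct (finite_representatives (letter l) l (S l)) as (es & Hes & Hrep).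
  apply Forall_forall in Hes.
  destruct (HC (fun x => x)) as (x0 & _ & _); [apply M_from_id|].
  assert (Hword : forall u, incl u es -> Forall (letter l) (u ++ es)).
  { intros u Hu; apply Forall_app; split; [|assumption].
    eapply incl_Forall; eassumption. }
  pose (word := fun u w => M^l w /\ tilde w l = l + length u /\
                           tilde w (S l) = S (tilde w l) /\ code l u w).
  pose (good := fun u x => In x L /\ exists w, word (u ++ es) w /\ C w x).
  pose (c := fun u => epsilon (inhabits x0) (good u)).
  assert (Hc : forall u, incl u es -> good u (c u)).
  { intros u Hu; apply epsilon_spec.
    destruct (word_exists l (u ++ es) (Hword u Hu)) as (w & Hw).
    destruct (HC w) as (x & Hx & HCx); [apply Hw|].
    exists x; split; [assumption|exists w; split; [exact Hw|assumption]]. }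
  (* The word determines [z] on level [l] and [z] is the identity below, so the chosen colour is
     valid for every realization. *)
  assert (Huse : forall u z, incl u es -> M^l z -> code l (u ++ es) z -> C z (c u)).
  { intros u z Hu Hz Hcz; destruct (Hc u Hu) as (_ & w & (Hw & _ & _ & Hcw) & HCw).
    apply (Hext w); [|assumption]; intros a Ha.
    destruct (Nat.eq_dec (ell a) l) as [El|El].
    - apply (code_unique l (u ++ es)); auto.
    - rewrite (proj2 Hw), (proj2 Hz) by lia; reflexivity. }
  destruct (left_variable_word c L es) as (s & v & Hs & Hv & Hmono).
  { intros u Hu; apply Hc, Hu. }
  destruct (word_exists l (s ++ es) (Hword s Hs)) as (w & Hw & Et & En & Hcw).
  destruct (left_variable_word_realized l es es s w v) as (h & Hh & Hch); auto.
  { apply incl_refl. }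
  exists w, h, (c s); repeat split; auto; try apply Hw; try apply Hh.
  intros e He; destruct (Hrep e He) as (e' & He' & E).
  { intros a Ha; rewrite level_M by apply He; rewrite <- (proj2 He).
    apply tilde_le; [apply He|assumption]. }
  apply (Hext (fun a => h (w (e' a)))).
  { intros a Ha; rewrite E by assumption; reflexivity. }
  rewrite <- (Hmono e' He'); apply Huse.
  - apply incl_app; [apply subst_incl; assumption|apply incl_cons; assumption].
  - rewrite Forall_forall in Hes.
    assert (Hl : l <= tilde w l) by lia.
    apply (M_from_comp l h (fun a => w (e' a))).
    + eapply M_from_weaken; [|eassumption]; lia.
    + apply M_from_comp; [assumption|apply Hes, He'].
  - rewrite <- app_assoc; apply Hch, He'.
Qed.


(** * Large sets *)

Definition local {X : Type} (l : nat) (f : (T -> T) -> X) : Prop :=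
  forall z z', eqon l z z' -> f z = f z'.

Definition large (l : nat) (Y : (T -> T) -> Prop) : Prop :=
  forall F, M^l F -> exists g, M^l g /\ Y (fun a => F (g a)).

Lemma level_le F a n : M F -> ell a <= n -> ell (F a) <= tilde F n.
Proof.
  intros HF Ha; rewrite level_M by assumption.
  apply tilde_le; assumption.
Qed.

Lemma level_lt F a n : M F -> ell a < n -> ell (F a) < tilde F n.
Proof.
  intros HF Ha; rewrite level_M by assumption.
  apply tilde_lt; assumption.
Qed.

Lemma local_iff l (Y : (T -> T) -> Prop) z z' : local l Y -> eqon l z z' -> Y z -> Y z'.
Proof. intros HY E H; rewrite <- (HY _ _ E); assumption. Qed.

(* Otherwise, copies that avoid [Y] one level at a time could be composed into a single
   one. *)
Lemma large_bounded l Y : local l Y -> large l Y ->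
  exists N, l <= N /\ forall z, M^N z ->
    exists g, M^l g /\ tilde g l = N /\ Y (fun a => z (g a)).
Proof.
  intros Hloc HY.
  destruct (classic (forall N, l <= N -> exists z, M^N z /\
    forall g, M^l g -> tilde g l = N -> ~ Y (fun a => z (g a)))) as [Hn|Hn].
  2: { apply not_all_ex_not in Hn as [N Hn]; apply imply_to_and in Hn as [HN Hn].
       exists N; split; [assumption|]; intros z Hz; apply NNPP; intros Hg.
       apply Hn; exists z; split; [assumption|]; intros g H1 H2 H3.
       apply Hg; exists g; auto. }
  exfalso.
  destruct (dependent_choice (fun _ F => M^l F)
    (fun i F F' => (forall a, ell a < l + i -> F' a = F a) /\
       forall g, M^l g -> tilde g l = l + i -> ~ Y (fun a => F' (g a))) (fun x => x))
    as (Fs & _ & HFs).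
  - apply M_from_id.
  - intros i F HF.
    assert (HN : l + i <= tilde F (l + i)) by (apply tilde_ge, HF).
    (* If [g] takes [l] to [l + i], then [F o g] takes it to this level, where [z] avoids [Y]. *)
    destruct (Hn (tilde F (l + i))) as (z & Hz & Hav); [lia|].
    exists (fun a => z (F a)); split; [|split].
    + apply M_from_comp; [|assumption].
      eapply M_from_weaken; [|eassumption]; lia.
    + intros a Ha; apply Hz, level_lt; [apply HF|assumption].
    + intros g Hg Et; apply (Hav (fun a => F (g a))).
      * apply M_from_comp; assumption.
      * rewrite tilde_comp, Et by (apply HF || apply Hg); reflexivity.
  - destruct (M_from_limit l l Fs) as (F & HF & E); auto.
    { intros i; apply HFs. }
    { intros i; apply HFs. }
    destruct (HY F HF) as (g & Hg & Hyes).
    assert (Hge : l <= tilde g l) by (apply tilde_ge, Hg).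
    destruct (HFs (tilde g l - l)) as (_ & _ & Hav).
    apply (Hav g Hg); [lia|]; revert Hyes; apply local_iff with l; [assumption|].
    intros a Ha; apply E; assert (H := level_le g a l (proj1 Hg) Ha); lia.
Qed.

(** The maps [w] are treated one after another, each by composing with a witness [K] against
    largeness. As [K] is the identity up to the level reached by all [w], membership of [w] in [Y]
    is unchanged, and earlier refutations persist because [K o h] is one more [h]. *)
Lemma refute_lines l Y i P (L : list (T -> T)) :
  local l Y -> M^l P ->
  (forall P w, M^l P -> M^l w -> tilde w (S l) = S (tilde w l) ->
     Y (fun a => P (w a)) ->
     ~ large (S (tilde w l)) (fun h => forall e, letter l e -> Y (fun a => P (h (w (e a)))))) ->
  (forall w, In w L -> M^l w /\ tilde w (S l) = S (tilde w l) /\ tilde w l = l + i) ->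
  exists Q, M^(S l + i) Q /\ forall w, In w L -> Y (fun a => P (Q (w a))) ->
    forall h, M^(S (tilde w l)) h ->
      ~ forall e, letter l e -> Y (fun a => P (Q (h (w (e a))))).
Proof.
  intros Hloc HP Hneg; induction L as [|w L IH]; intros HL.
  { exists (fun x => x); split; [apply M_from_id|intros w []]. }
  destruct IH as (Q & HQ & Hav); [intros w' Hw'; apply HL; simpl; auto|].
  destruct (HL w (or_introl eq_refl)) as (Hw & En & Et).
  destruct (classic (Y (fun a => P (Q (w a))))) as [Hy|Hy].
  - assert (HPQ : M^l (fun a => P (Q a))).
    { apply M_from_comp; [assumption|].
      eapply M_from_weaken; [|eassumption]; lia. }
    specialize (Hneg _ w HPQ Hw En Hy).
    apply not_all_ex_not in Hneg as [K HK]; apply imply_to_and in HK as [HK Hno].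
    rewrite Et in HK.
    exists (fun a => Q (K a)); split; [apply M_from_comp; assumption|].
    intros w' Hw' Hy' h Hh Hall.
    destruct Hw' as [<-|Hw'].
    + apply Hno; exists h; rewrite Et in *; auto.
    + destruct (HL w') as (HMw' & En' & Et'); [simpl; auto|].
      apply (Hav w' Hw') with (fun a => K (h a)).
      * revert Hy'; apply local_iff with l; [assumption|].
        intros a Ha; rewrite (proj2 HK (w' a)); [reflexivity|].
        assert (H := level_le w' a l (proj1 HMw') Ha); lia.
      * rewrite Et' in *; apply M_from_comp; assumption.
      * exact Hall.
  - exists Q; split; [assumption|]; intros w' [<-|Hw']; [contradiction|auto].
Qed.

(** Otherwise fusion yields a copy [K] in which no [w] in [Y] has all its one-letter extensions put
    into [Y] by a single [h]. Colouring each [z] by a [g] with [K o z o g] in [Y] and taking a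
    monochromatic left variable word produces exactly such a [w] and [h]. *)
Lemma large_extend l Y : local l Y -> large l Y ->
  exists P w, M^l P /\ M^l w /\ tilde w (S l) = S (tilde w l) /\ Y (fun a => P (w a)) /\
    large (S (tilde w l)) (fun h => forall e, letter l e -> Y (fun a => P (h (w (e a))))).
Proof.
  intros Hloc HY; apply NNPP; intros Hn.
  assert (Hneg : forall P w, M^l P -> M^l w -> tilde w (S l) = S (tilde w l) ->
     Y (fun a => P (w a)) ->
     ~ large (S (tilde w l)) (fun h => forall e, letter l e -> Y (fun a => P (h (w (e a)))))).
  { intros P w HP Hw En Hy Hl; apply Hn; exists P, w; auto. }
  clear Hn.
  destruct (fusion l (S l) (fun i P =>
    forall w, M^l w -> tilde w (S l) = S (tilde w l) -> tilde w l = l + i ->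
      Y (fun a => P (w a)) -> forall h, M^(S (tilde w l)) h ->
      ~ forall e, letter l e -> Y (fun a => P (h (w (e a)))))) as (K & HK & Hfus).
  { lia. }
  { intros i P HP.
    destruct (finite_representatives 
      (fun w => M^l w /\ tilde w (S l) = S (tilde w l) /\ tilde w l = l + i) (S l) (S (l + i)))
      as (L & HL & Hrep).
    destruct (refute_lines l Y i P L Hloc HP Hneg HL) as (Q & HQ & Hav).
    exists Q; split; [assumption|]; intros w Hw En Et Hy h Hh Hall.
    destruct (Hrep w) as (G & HG & E); auto.
    { intros a Ha; rewrite <- Et, <- En; apply level_le; [apply Hw|assumption]. }
    destruct (HL G HG) as (_ & _ & EtG).
    apply (Hav G HG) with h.
    - revert Hy; apply local_iff with l; [assumption|].
      intros a Ha; rewrite E by lia; reflexivity.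
    - rewrite EtG, <- Et; assumption.
    - intros e He; generalize (Hall e He); apply local_iff with l; [assumption|].
      intros a Ha; rewrite E; [reflexivity|].
      rewrite <- (proj2 He); apply level_le; [apply He|assumption]. }
  destruct (large_bounded l (fun g => Y (fun a => K (g a)))) as (N & HN & HB).
  { intros z z' E; apply Hloc; intros a Ha; rewrite E; auto. }
  { intros F HF; destruct (HY (fun a => K (F a))) as (g & Hg & Hy).
    - apply M_from_comp; assumption.
    - exists g; auto. }
  (* Without a gap after [N], a letter at [l] is transported along [g] to a letter at [N]. *)
  pose (start := fun g => M^l g /\ tilde g l = N /\ tilde g (S l) = S N).
  destruct (finite_representatives start l N) as (gs & Hgs & Hrep).
  destruct (monochromatic_left_variable N
    (fun z g => start g /\ Y (fun a => K (z (g a)))) gs)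
    as (w & h & g & Hw & En & Hh & (Hg & Hyw) & Hline).
  { intros z z' g E (Hg & Hy); split; [assumption|].
    revert Hy; apply local_iff with l; [assumption|].
    intros a Ha; rewrite E; [reflexivity|].
    destruct Hg as (Hg & <- & _); apply level_le; [apply Hg|assumption]. }
  { intros z Hz; destruct (HB z Hz) as (g & Hg & Et & Hy).
    destruct (M_from_normalize g l l) as (g1 & Hg1 & E1 & Et1 & En1); auto.
    destruct (Hrep g1) as (g2 & Hg2 & E2).
    { repeat split; try apply Hg1; congruence. }
    { intros a Ha; rewrite <- Et, <- Et1; apply level_le; [apply Hg1|assumption]. }
    exists g2; repeat split; auto; try apply (Hgs g2 Hg2).
    revert Hy; apply local_iff with l; [assumption|].
    intros a Ha; rewrite <- E2, E1 by assumption; reflexivity. }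
  destruct Hg as (Hg & Et & Eg).
  assert (HNw : N <= tilde w N) by (apply tilde_ge, Hw).
  assert (Hwg : M^l (fun a => w (g a))).
  { apply M_from_comp; [|assumption].
    eapply M_from_weaken; [|eassumption]; assumption. }
  assert (Ewg : tilde (fun a => w (g a)) l = tilde w N).
  { rewrite tilde_comp, Et by (apply Hw || apply Hg); reflexivity. }
  (* The stage belongs to the level that [w o g] gives to [l]; the second level bounds all nodes met
     by the one-letter extensions. *)
  destruct (Hfus (tilde w N - l) (tilde h (tilde w (S N)))) as (P & Q & HP & HD & HQ & E).
  assert (HhM : tilde w N <= tilde h (tilde w (S N))).
  { rewrite En; assert (H := tilde_ge h (S (tilde w N)) (proj1 Hh)); lia. }
  apply (HD (fun a => w (g a))) with (fun a => Q (h a)); auto.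
  - rewrite Ewg, tilde_comp, Eg, En by (apply Hw || apply Hg); reflexivity.
  - lia.
  - revert Hyw; apply local_iff with l; [assumption|].
    intros a Ha.
    assert (H : ell (w (g a)) <= tilde w N).
    { rewrite <- Ewg; apply (level_le (fun a => w (g a))); [apply Hwg|assumption]. }
    rewrite E by lia.
    rewrite (proj2 HQ) by lia; reflexivity.
  - rewrite Ewg; apply M_from_comp; [|assumption].
    eapply M_from_weaken; [|eassumption]; lia.
  - intros e He.
    destruct (M_cone g e l (proj1 Hg) (proj1 He)) as (e' & He' & Ee' & Ege).
    rewrite Et, (proj2 He), Eg in *.
    destruct (Hline e' (conj He' Ee')) as (_ & Hy).
    revert Hy; apply local_iff with l; [assumption|].
    intros a Ha; rewrite <- Ege by assumption; apply E.
    apply level_le; [apply Hh|]; apply level_le; [apply Hw|].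
    rewrite <- Eg; apply level_le; [apply Hg|].
    rewrite <- (proj2 He); apply level_le; [apply He|assumption].
Qed.

(* A copy of the tree inside [Y] is the limit of the maps [P_i o G_i], where [G_i] takes
   level [n + i] to the level at which the [i]-th large set lives. *)
Lemma large_contains_copy n Y : local n Y -> large n Y ->
  exists F, M^n F /\ forall g, M^n g -> Y (fun a => F (g a)).
Proof.
  intros Hloc HY.
  destruct (dependent_choice
    (fun i PG => M^n (fst PG) /\ M^n (snd PG) /\
       large (tilde (snd PG) (n + i)) (fun h => forall g, M^n g -> tilde g n = n + i ->
         Y (fun a => fst PG (h (snd PG (g a))))))
    (fun i PG PG' =>
       (forall a, ell a < n + i -> fst PG' (snd PG' a) = fst PG (snd PG a)) /\
       forall g, M^n g -> tilde g n = n + i -> Y (fun a => fst PG' (snd PG' (g a))))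
    (fun x => x, fun x => x)) as (PGs & _ & HPG).
  - simpl; repeat split; try apply M_id.
    rewrite tilde_id, Nat.add_0_r; intros F HF.
    destruct (HY F HF) as (g & Hg & Hy); exists g; split; [assumption|].
    intros g' Hg' Et; revert Hy; apply local_iff with n; [assumption|].
    (* At stage 0 the only [g'] to consider is the identity up to level [n]. *)
    intros a Ha; rewrite (M_from_eqon_id n g') by auto; reflexivity.
  - intros i [P G] (HP & HG & Hlarge); simpl in *.
    assert (Hge : n + i <= tilde G (n + i)) by (apply tilde_ge, HG).
    pose (Y' := fun h : T -> T => forall g, M^n g -> tilde g n = n + i ->
                  Y (fun a => P (h (G (g a))))).
    assert (Hloc' : local (tilde G (n + i)) Y').
    { intros z z' E.
      assert (E' : forall g, M^n g -> tilde g n = n + i ->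
                (Y (fun a => P (z (G (g a)))) = Y (fun a => P (z' (G (g a)))))).
      { intros g Hg Et; apply Hloc; intros a Ha; rewrite E; [reflexivity|].
        rewrite <- Et; apply level_le; [apply HG|]; apply level_le; [apply Hg|assumption]. }
      apply propositional_extensionality; unfold Y'.
      split; intros H g Hg Et; specialize (H g Hg Et); rewrite E' in *; auto. }
    destruct (large_extend (tilde G (n + i)) Y' Hloc' Hlarge)
      as (P0 & w & HP0 & Hw & En & Hyw & Hlarge').
    destruct (M_from_normalize G (n + i) n) as (G1 & HG1 & E1 & Et1 & En1).
    { lia. }
    { assumption. }
    exists (fun a => P (P0 a), fun a => w (G1 a)); simpl.
    assert (Et' : tilde (fun a => w (G1 a)) (n + S i) = S (tilde w (tilde G (n + i)))).
    { rewrite tilde_comp by (apply Hw || apply HG1).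
      rewrite Nat.add_succ_r, En1, Et1; assumption. }
    repeat split.
    + apply M_comp; [apply HP|apply HP0].
    + intros a Ha; rewrite (proj2 HP0) by lia; apply HP, Ha.
    + apply M_comp; [apply Hw|apply HG1].
    + intros a Ha; rewrite (proj2 HG1) by lia; apply Hw; lia.
    + rewrite Et'; intros F HF; destruct (Hlarge' F HF) as (h & Hh & Hall).
      exists h; split; [assumption|]; intros g Hg Et.
      (* Split off the last letter [e] of [g] and move it through [G1]: it becomes a letter at level
         [tilde G (n + i)], one of those handled by [Hall]. *)
      destruct (M_split g n (n + i)) as (g' & e & Hg' & He & Etg' & Ete & Eg);
        [assumption|lia|lia|].
      destruct (M_cone G1 e (n + i) (proj1 HG1) He) as (e' & He' & Ete' & Ee').
      rewrite Ete, Et, Nat.add_succ_r, En1, Et1 in Ete'; rewrite Et1 in He'.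
      generalize (Hall e' (conj He' Ete') g' Hg' Etg'); apply local_iff with n; auto.
      intros a Ha.
      assert (Hl : ell (g' a) <= n + i).
      { rewrite <- Etg'; apply level_le; [apply Hg'|assumption]. }
      rewrite Eg, Ee', E1 by assumption; reflexivity.
    + intros a Ha; rewrite E1 by lia.
      assert (Hl : ell (G a) < tilde G (n + i)) by (apply level_lt; [apply HG|assumption]).
      rewrite (proj2 Hw), (proj2 HP0) by assumption; reflexivity.
    + intros g Hg Et; generalize (Hyw g Hg Et); apply local_iff with n; auto.
      intros a Ha; rewrite E1; [reflexivity|].
      rewrite <- Et; apply level_le; [apply Hg|assumption].
  - destruct (M_from_limit n n (fun i a => fst (PGs i) (snd (PGs i) a)))
      as (F & HF & E); auto.
    { intros i; apply M_from_comp; apply HPG. }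
    { intros i; apply HPG. }
    exists F; split; [assumption|]; intros g Hg.
    assert (Hge : n <= tilde g n) by (apply tilde_ge, Hg).
    destruct (HPG (tilde g n - n)) as (_ & _ & Hy).
    specialize (Hy g Hg ltac:(lia)); revert Hy; apply local_iff with n; [assumption|].
    intros a Ha; symmetry; apply (E (S (tilde g n - n))).
    assert (H := level_le g a n (proj1 Hg) Ha); lia.
Qed.

(** If the class of colour [r] is large, it contains a copy; if not, some copy avoids it and one
    colour fewer remains. *)
Lemma monochromatic_copy n r (chi : (T -> T) -> nat) :
  local n chi -> (forall g, M^n g -> chi g < r) ->
  exists F, M^n F /\ forall g g', M^n g -> M^n g' ->
    chi (fun a => F (g a)) = chi (fun a => F (g' a)).
Proof.
  revert chi; induction r as [|r IH]; intros chi Hloc Hr.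
  { specialize (Hr _ (M_from_id n)); lia. }
  destruct (classic (large n (fun g => chi g = r))) as [Hl|Hl].
  - destruct (large_contains_copy n (fun g => chi g = r)) as (F & HF & E); auto.
    { intros z z' Ez; rewrite (Hloc _ _ Ez); reflexivity. }
    exists F; split; [assumption|]; intros g g' Hg Hg'; rewrite !E; auto.
  - apply not_all_ex_not in Hl as [F HF]; apply imply_to_and in HF as [HF Hno].
    destruct (IH (fun g => chi (fun a => F (g a)))) as (G & HG & E).
    + intros z z' Ez; apply Hloc; intros a Ha; rewrite Ez; auto.
    + intros g Hg.
      assert (chi (fun a => F (g a)) < S r) by (apply Hr, M_from_comp; auto).
      assert (chi (fun a => F (g a)) <> r) by (intros H'; apply Hno; eauto).
      lia.
    + exists (fun a => F (G a)); split; [apply M_from_comp; assumption|exact E].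
Qed.

(** * From one level to several levels *)

Lemma M_determined F F' q :
  M F -> M F' -> (forall a, ell a < q -> F a = F' a) ->
  tilde F q = match q with 0 => 0 | S p => S (tilde F p) end ->
  tilde F' q = tilde F q -> eqon q F F'.
Proof.
  intros HF HF' E Et Et' a Ha.
  destruct (Nat.eq_dec (ell a) q) as [El|El]; [|apply E; lia].
  destruct q as [|p].
  - assert (H : forall G, M G -> tilde G 0 = 0 -> G a = a).
    { intros G HG EG; symmetry; apply le_level_eq.
      - apply M_root; auto using le_refl.
      - rewrite level_M, El by assumption; lia. }
    rewrite !H; auto; congruence.
  - destruct (imm_pred a p El) as (b & Hb & Eb).
    destruct (Ssucc_exists _ _ Hb) as (args & c & HS).
    (* With no gap before its level, [G a] is exactly the successor of [F b] with data [map F args],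
       [c], hence is determined by the values below. *)
    assert (H : forall G, M G -> (forall x, ell x < S p -> G x = F x) ->
                  tilde G (S p) = tilde F (S p) ->
                  Ssucc (F b) (map F args) c = Some (G a)).
    { intros G HG EG Etg.
      destruct (M_Ssucc G _ _ _ _ HG HS) as (x & Hx & Hle).
      rewrite EG in Hx by lia; rewrite (map_ext_in G F) in Hx.
      - rewrite Hx; f_equal; apply le_level_eq; [assumption|].
        apply Ssucc_imm, imm_succ_level in Hx.
        rewrite Hx, !level_M, El, Eb, Etg, Et by assumption; lia.
      - intros y Hy; apply EG; apply (Ssucc_args _ _ _ _ _ HS) in Hy; lia. }
    assert (H1 := H F HF ltac:(auto) eq_refl).
    assert (H2 := H F' HF' ltac:(intros; symmetry; auto) Et').
    congruence.
Qed.

(** The maps [f] are treated one at a time; composing with a further copy [F] keeps earlier ones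
    frozen, because [F o h] is again in [M^m]. *)
Lemma freeze_extensions n q m r chi P (L : list (T -> T)) :
  local q chi -> (forall g, M^n g -> chi g < r) -> n <= m -> M^n P ->
  (forall f, In f L -> M^n f /\ tilde f q = m) ->
  exists Q, M^m Q /\ forall f, In f L -> forall h h', M^m h -> M^m h' ->
    chi (fun a => P (Q (h (f a)))) = chi (fun a => P (Q (h' (f a)))).
Proof.
  intros Hloc Hr Hnm HP; induction L as [|f L IH]; intros HL.
  { exists (fun x => x); split; [apply M_from_id|intros f []]. }
  destruct IH as (Q & HQ & EQ); [intros; apply HL; simpl; auto|].
  destruct (HL f (or_introl eq_refl)) as (Hf & Et).
  destruct (monochromatic_copy m r (fun h => chi (fun a => P (Q (h (f a)))))) as (F & HF & EF).
  - intros z z' E; apply Hloc; intros a Ha; rewrite E; [reflexivity|].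
    rewrite <- Et; apply level_le; [apply Hf|assumption].
  - intros h Hh; apply Hr.
    apply (M_from_comp n P (fun a => Q (h (f a)))); [assumption|].
    apply (M_from_comp n Q (fun a => h (f a)));
      [eapply M_from_weaken; eassumption|].
    apply M_from_comp; [eapply M_from_weaken; eassumption|assumption].
  - exists (fun a => Q (F a)); split; [apply M_from_comp; assumption|].
    intros f' [<-|Hf'] h h' Hh Hh'; [apply (EF h h'); assumption|].
    apply (EQ f' Hf' (fun a => F (h a)) (fun a => F (h' a)));
      apply M_from_comp; assumption.
Qed.

Lemma end_homogeneous n q r chi :
  n <= q -> local q chi -> (forall g, M^n g -> chi g < r) ->
  exists K, M^n K /\ forall f f', M^n f -> M^n f' ->
    (forall a, ell a < q -> f a = f' a) ->
    chi (fun a => K (f a)) = chi (fun a => K (f' a)).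
Proof.
  intros Hnq Hloc Hr.
  destruct (fusion n q (fun i P =>
    forall f, M^n f -> tilde f q = q + i -> forall h h', M^(q + i) h -> M^(q + i) h' ->
      chi (fun a => P (h (f a))) = chi (fun a => P (h' (f a))))) as (K & HK & Hfus).
  { assumption. }
  { intros i P HP.
    destruct (finite_representatives (fun f => M^n f /\ tilde f q = q + i) q (q + i))
      as (L & HL & Hrep).
    destruct (freeze_extensions n q (q + i) r chi P L) as (Q & HQ & EQ); auto; [lia|].
    exists Q; split; [assumption|]; intros f Hf Et h h' Hh Hh'.
    destruct (Hrep f (conj Hf Et)) as (f0 & Hf0 & E).
    { intros a Ha; rewrite <- Et; apply level_le; [apply Hf|assumption]. }
    transitivity (chi (fun a => P (Q (h (f0 a))))).
    { apply Hloc; intros a Ha; rewrite E; auto. }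
    rewrite (EQ f0 Hf0 h h') by assumption.
    apply Hloc; intros a Ha; rewrite E; auto. }
  exists K; split; [assumption|]; intros f f' Hf Hf' Eff.
  (* The least level to which [q] can go once the levels below [q] are mapped as by [f]. Factoring
     [f] and [f'] there leaves the same inner map up to level [q], and the outer maps were frozen at
     stage [m - q]. *)
  set (m := match q with 0 => 0 | S p => S (tilde f p) end).
  assert (Hdec : forall g, M^n g -> (forall a, ell a < q -> g a = f a) ->
    exists h g1, M^m h /\ M g1 /\ tilde g1 q = m /\ eqon q g (fun a => h (g1 a)) /\
      forall a, ell a < q -> g1 a = f a).
  { intros g Hg Egf.
    assert (Etg : forall i, i < q -> tilde g i = tilde f i).
    { intros i Hi; destruct (level_inhabited i) as [a <-].
      rewrite <- !level_M, Egf by (apply Hg || apply Hf || assumption).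
      reflexivity. }
    destruct (M_decompose g q m) as (h & g1 & Hh & Hg1 & Et & E & E1).
    - apply Hg.
    - intros i Hi; rewrite Etg by assumption; unfold m.
      destruct q as [|p]; [lia|]; apply Nat.lt_succ_r, tilde_le; [apply Hf|lia].
    - unfold m; destruct q as [|p]; [lia|]; rewrite <- (Etg p) by lia.
      apply tilde_lt; [apply Hg|lia].
    - exists h, g1; repeat split; auto; try apply Hh.
      intros a Ha; rewrite E1, Egf; auto. }
  destruct (Hdec f Hf) as (h & g & Hh & Hg & Et & E & Eg); [reflexivity|].
  destruct (Hdec f' Hf') as (h' & g' & Hh' & Hg' & Et' & E' & Eg');
    [intros; symmetry; auto|].
  assert (Egg : eqon q g g').
  { apply M_determined; auto; [|rewrite Et| congruence].
    - intros a Ha; rewrite Eg, Eg' by assumption; reflexivity.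
    - unfold m; destruct q as [|p]; [reflexivity|]; f_equal.
      destruct (level_inhabited p) as [a <-].
      rewrite <- !level_M, Eg by (auto; apply Hf); reflexivity. }
  assert (Hgn : M^n g).
  { split; [assumption|]; intros a Ha; rewrite Eg by lia; apply Hf, Ha. }
  assert (Hqm : q <= m) by (rewrite <- Et; apply tilde_ge; assumption).
  destruct (Hfus (m - q) (tilde f q + tilde f' q)) as (P & Q & HP & HD & HQ & EK).
  replace (q + (m - q)) with m in * by lia.
  assert (HQm : M^m Q) by (eapply M_from_weaken; [|eassumption]; lia).
  transitivity (chi (fun a => P (Q (h (g a))))).
  { apply Hloc; intros a Ha; rewrite <- E by assumption; apply EK.
    assert (H := level_le f a q (proj1 Hf) Ha); lia. }
  rewrite (HD g Hgn Et (fun a => Q (h a)) (fun a => Q (h' a)))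
    by (apply M_from_comp; assumption).
  apply Hloc; intros a Ha; rewrite Egg, <- E' by assumption; symmetry; apply EK.
  assert (H := level_le f' a q (proj1 Hf') Ha); lia.
Qed.

Lemma ramsey_copy n k r (chi : (T -> T) -> nat) :
  (forall z z', (forall a, ell a < n + k -> z a = z' a) -> chi z = chi z') ->
  (forall g, M^n g -> chi g < r) ->
  exists F, M^n F /\ forall g g', M^n g -> M^n g' ->
    chi (fun a => F (g a)) = chi (fun a => F (g' a)).
Proof.
  revert chi; induction k as [|k IH]; intros chi Hloc Hr.
  - exists (fun x => x); split; [apply M_from_id|].
    intros g g' Hg Hg'; apply Hloc; intros a Ha.
    rewrite (proj2 Hg), (proj2 Hg') by lia; reflexivity.
  - destruct (end_homogeneous n (n + k) r chi) as (K & HK & EK); auto; [lia| |].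
    { intros z z' E; apply Hloc; intros a Ha; apply E; lia. }
    (* The colour of a restriction is read off from any extension of it; by [EK] the choice does not
       matter. Since [D] sees only the restriction of [g], the new colouring is local even for maps
       outside [M]. *)
    pose (D := fun g c => exists f, M^n f /\ (forall a, ell a < n + k -> f a = g a) /\
                            c = chi (fun a => K (f a))).
    assert (HD : forall g, M^n g -> epsilon (inhabits 0) (D g) = chi (fun a => K (g a))).
    { intros g Hg; destruct (epsilon_spec (inhabits 0) (D g)) as (f & Hf & E & ->).
      - exists (chi (fun a => K (g a))), g; auto.
      - apply EK; assumption. }
    destruct (IH (fun g => epsilon (inhabits 0) (D g))) as (F & HF & EF).
    { intros z z' E; f_equal; apply functional_extensionality; intros c.
      apply propositional_extensionality; unfold D.
      split; intros (f & Hf & Ef & Hc); exists f; repeat split; auto; try apply Hf;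
        intros a Ha; rewrite Ef, E; auto. }
    { intros g Hg; rewrite HD by assumption; apply Hr, M_from_comp; assumption. }
    exists (fun a => K (F a)); split; [apply M_from_comp; assumption|].
    intros g g' Hg Hg'.
    assert (E := EF g g' Hg Hg'); cbv beta in E.
    rewrite !HD in E by (apply M_from_comp; assumption); exact E.
Qed.

End SMTree.

Theorem mainTheorem1 (T : Type) (le : T -> T -> Prop) (Sigma : Type)
  (Ssucc : T -> list T -> Sigma -> option T) (M : (T -> T) -> Prop) :
  is_SM_tree le Ssucc M ->
  forall (n k : nat) (chi : (T -> option T) -> nat),
    (exists r, forall g, AM le M n k g -> chi g < r) ->
    exists F, M_from le M n F /\
      forall g1 g2, AM le M n k g1 -> AM le M n k g2 ->
        chi (comp_partial F g1) = chi (comp_partial F g2).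
Proof.
  intros HT n k chi [r Hr].
  (* Restriction turns the colouring of partial maps into one of total maps that depends only on
     levels below [n + k]. *)
  pose (res := fun (F : T -> T) a => if level le a <? n + k then Some (F a) else None).
  destruct (ramsey_copy _ _ _ HT n k r (fun F => chi (res F))) as (F & HF & E).
  - intros z z' Ez; f_equal; apply functional_extensionality; intros a; unfold res.
    destruct (Nat.ltb_spec (level le a) (n + k)); [rewrite Ez by assumption|]; reflexivity.
  - intros g Hg; apply Hr; exists g; split; [assumption|reflexivity].
  - exists F; split; [assumption|]; intros g1 g2 (G1 & HG1 & E1) (G2 & HG2 & E2).
    assert (Hres : forall g G, (forall a, g a = res G a) ->
              comp_partial F g = res (fun a => F (G a))).
    { intros g G Eg; apply functional_extensionality; intros a.
      unfold comp_partial; rewrite Eg; unfold res.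
      destruct (level le a <? n + k); reflexivity. }
    rewrite (Hres g1 G1 E1), (Hres g2 G2 E2); apply E; assumption.
Qed.
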